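(* Let $f(z)=z+\sum_{n=2}^{\infty}a_nz^n$ belong to $\mathcal{S}^*_{\xi}$. Then \[ |a_2|\le 1,\qquad |a_3|\le 1,\qquad |a_4|\le \frac{17}{18}. \] These bounds are sharp: each of them is attained with equality by some function in $\mathcal{S}^*_{\xi}$.
   Context: $\mathbb{D}=\{z\in\mathbb{C}:|z|<1\}$. $\mathcal{A}$ is the class of analytic functions $f$ on $\mathbb{D}$ of the form $f(z)=z+\sum_{n\ge2}a_nz^n$. For analytic $f,g$ on $\mathbb{D}$, $f\prec g$ (subordination) means there is an analytic $w:\mathbb{D}\to\mathbb{D}$ with $w(0)=0$ and $f=g\circ w$. Let $\xi(z)=1+\frac{\sin z}{1-z}$ for $z\in\mathbb{D}$, and $\mathcal{S}^*_{\xi}=\{f\in\mathcal{A}: \frac{zf'(z)}{f(z)}\prec \xi(z)\}$. *)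

(* Defs.v *)
From Stdlib Require Import Reals Arith Factorial.
From Coquelicot Require Import Coquelicot.
Open Scope R_scope.

Definition inD (z : C) : Prop := Cmod z < 1.

Definition analytic_on_D (f : C -> C) : Prop :=
  forall z : C, inD z -> @ex_derive C_AbsRing C_NormedModule f z.

Definition Csin_term (z : C) (k : nat) : C :=
  Cmult (RtoC ((-1) ^ k / INR (fact (2 * k + 1)))) (Cpow z (2 * k + 1)).

Definition Csin (z : C) : C :=
  (Series (fun k => Re (Csin_term z k)), Series (fun k => Im (Csin_term z k))).

Definition xi (z : C) : C := Cplus (RtoC 1) (Cdiv (Csin z) (Cminus (RtoC 1) z)).

Definition in_A (f : C -> C) : Prop :=
  analytic_on_D f /\ f (RtoC 0) = RtoC 0 /\ @is_derive C_AbsRing C_NormedModule f (RtoC 0) (RtoC 1).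

(* f in S*_xi : z f'(z)/f(z) is subordinate to xi, i.e. there is an analytic
   Schwarz function w : D -> D with w(0) = 0 and z f'(z)/f(z) = xi(w(z)) on D.
   At z = 0 the quotient z f'(z)/f(z) is understood as its removable value
   f'(0) = 1 = xi(0) = xi(w 0), so the identity is required for z <> 0 only,
   together with f(z) <> 0 there (so that z f'/f is analytic on D). *)
Definition S_star_xi (f : C -> C) : Prop :=
  in_A f /\
  exists w : C -> C,
    analytic_on_D w /\ w (RtoC 0) = RtoC 0 /\ (forall z, inD z -> inD (w z)) /\
    forall z : C, inD z -> z <> RtoC 0 ->
      f z <> RtoC 0 /\
      forall d : C, @is_derive C_AbsRing C_NormedModule f z d ->
        Cdiv (Cmult z d) (f z) = xi (w z).

Definition coeffs_of (f : C -> C) (a : nat -> C) : Prop :=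
  forall z : C, inD z -> @is_pseries C_AbsRing C_NormedModule a z (f z).

(* Main.v *)
Require Import Defs.
From Stdlib Require Import Reals Factorial Lra Lia ClassicalEpsilon.
From Coquelicot Require Import Coquelicot.
Open Scope R_scope.

(** If [w = k1 z + k2 z^2 + k3 z^3 + ...] is the Schwarz function of [f], comparing
    coefficients in [(f' - f/z) (1 - w) = (f/z) sin w] gives [a2 = k1],
    [2 a3 = k2 + 2 k1^2] and [3 a4 = k3 + 7/2 k1 k2 + 17/6 k1^3].  The bounds follow from
    Schur's parametrisation [k2 = (1 - |k1|^2) g],
    [k3 = (1 - |k1|^2) ((1 - |g|^2) d - conj k1 g^2)] with [|g|, |d| <= 1].

    No Cauchy theory is needed: [f] is a power series by hypothesis, and since [xi'] has no
    zero on the disc, [w] inherits from [f] Taylor expansions of every order at every point.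
    For such functions the maximum principle is a second-derivative test.

    Equality holds in all three bounds for [w z = z], i.e. [z f' = f xi]; solving this
    equation by a recursion on the coefficients of [f / z] keeps them bounded by 1. *)

(** * Taylor expansions and the maximum principle *)

(** The definition [analytic_on_D] grants one complex derivative at each point, while comparing
    coefficients needs [w] to third order. Expansions are therefore carried by iterated divided
    differences: sums, products, inverses and composites close by induction on the order, and xi(w)
    = z f'/f can be solved for [w] one order at a time. Order three is also what the maximum
    principle consumes, an error O(h^3) against a gain of order h^2. Schur's algorithm divides by 1
    - conj(b) f, which vanishes once a parameter reaches modulus 1, as it does for the extremal w =
    z. It is therefore run on r w with r < 1, and r tends to 1 only in the three final inequalities,
    whose functionals are polynomials of degree at most 3 in r. The bound 17/18 is one third of the
    coefficient 17/6 of k1^3: the third functional is largest at k1 = 1, k2 = k3 = 0. *)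

Definition near (z : C) (P : C -> Prop) : Prop :=
  exists d : R, 0 < d /\ forall y : C, Cmod (y - z) < d -> P y.

Lemma near_imp (z : C) (P Q : C -> Prop) :
  (forall y, P y -> Q y) -> near z P -> near z Q.
Proof. intros H [d [Hd HP]]; exists d; split; auto. Qed.

Lemma near_and (z : C) (P Q : C -> Prop) :
  near z P -> near z Q -> near z (fun y => P y /\ Q y).
Proof.
  intros [d [Hd HP]] [e [He HQ]]; exists (Rmin d e); split.
  - now apply Rmin_pos.
  - intros y Hy; split; [apply HP | apply HQ];
      eapply Rlt_le_trans; eauto using Rmin_l, Rmin_r.
Qed.

Lemma near_true (z : C) (P : C -> Prop) : (forall y, P y) -> near z P.
Proof. intros H; exists 1; split; [lra | auto]. Qed.

Lemma Cmod_minus_diag (z : C) : Cmod (z - z) = 0.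
Proof. replace (z - z)%C with (RtoC 0) by ring. apply Cmod_0. Qed.

Lemma near_self (z : C) (P : C -> Prop) : near z P -> P z.
Proof. intros [d [Hd H]]; apply H; now rewrite Cmod_minus_diag. Qed.

Lemma near_ball (z : C) (d : R) : 0 < d -> near z (fun y => Cmod (y - z) < d).
Proof. intros Hd; exists d; auto. Qed.

Lemma Cmod_sym (x y : C) : Cmod (x - y) = Cmod (y - x).
Proof. rewrite <- (Cmod_opp (x - y)); f_equal; ring. Qed.

Lemma Cmod_le_plus_minus (x y : C) : Cmod x <= Cmod y + Cmod (x - y).
Proof.
  replace x with (y + (x - y))%C at 1 by ring. apply Cmod_triangle.
Qed.

Lemma near_inD (z : C) : inD z -> near z inD.
Proof.
  unfold inD; intros Hz; exists (1 - Cmod z); split; [lra|].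
  intros y Hy; pose proof (Cmod_le_plus_minus y z); lra.
Qed.

Definition cont (g : C -> C) (z : C) : Prop :=
  forall eps, 0 < eps -> near z (fun y => Cmod (g y - g z) < eps).

Lemma cont_comp_near (g : C -> C) (z : C) (P : C -> Prop) :
  cont g z -> near (g z) P -> near z (fun y => P (g y)).
Proof. intros Hg [d [Hd HP]]; eapply near_imp; [|apply (Hg d Hd)]; auto. Qed.

(* [taylor n z g]: g has a Taylor expansion of order n at z with remainder
   O(|y - z|^n), stated through iterated divided differences. *)
Fixpoint taylor (n : nat) (z : C) (g : C -> C) : Prop :=
  match n with
  | O => exists K : R, near z (fun y => Cmod (g y) <= K)
  | S m => exists g1 : C -> C,
      near z (fun y => g y = (g z + (y - z) * g1 y)%C) /\ taylor m z g1
  end.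

Lemma taylor_ext (n : nat) (z : C) (f g : C -> C) :
  near z (fun y => f y = g y) -> taylor n z f -> taylor n z g.
Proof.
  intros Heq; destruct n; simpl.
  - intros [K HK]; exists K.
    eapply near_imp; [|apply (near_and _ _ _ Heq HK)].
    intros y [<- Hy]; exact Hy.
  - intros [g1 [H1 H2]]; exists g1; split; [|exact H2].
    pose proof (near_self _ _ Heq) as Hz; simpl in Hz.
    eapply near_imp; [|apply (near_and _ _ _ Heq H1)].
    intros y [E1 E2]; now rewrite <- E1, <- Hz.
Qed.

(** The bound is made strictly positive so that later proofs can divide by it. *)
Lemma taylor_bounded (n : nat) : forall (z : C) (g : C -> C),
  taylor n z g -> exists K, 0 < K /\ near z (fun y => Cmod (g y) <= K).
Proof.
  induction n as [|n IH]; simpl; intros z g.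
  - intros [K HK]; exists (Rmax K 1); split.
    + eapply Rlt_le_trans; [|apply Rmax_r]; lra.
    + eapply near_imp; [|apply HK]; intros y Hy; simpl in Hy.
      eapply Rle_trans; [apply Hy | apply Rmax_l].
  - intros [g1 [H1 H2]]; destruct (IH _ _ H2) as [K [HK0 HK]].
    pose proof (Cmod_ge_0 (g z)).
    exists (Cmod (g z) + K); split; [lra|].
    eapply near_imp;
      [|apply (near_and _ _ _ (near_and _ _ _ H1 HK) (near_ball z 1 ltac:(lra)))].
    intros y [[E1 E2] E3]; simpl in E1, E2, E3; rewrite E1.
    eapply Rle_trans; [apply Cmod_triangle|]; rewrite Cmod_mult.
    pose proof (Cmod_ge_0 (y - z)); pose proof (Cmod_ge_0 (g1 y)); nra.
Qed.

Lemma taylor_S (n : nat) : forall (z : C) (g : C -> C),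
  taylor (S n) z g -> taylor n z g.
Proof.
  induction n as [|n IH]; intros z g H.
  - destruct (taylor_bounded _ _ _ H) as [K [_ HK]]; now exists K.
  - destruct H as [g1 [H1 H2]]; exists g1; split; [exact H1 | now apply IH].
Qed.

Lemma taylor_cont (n : nat) (z : C) (g : C -> C) : taylor (S n) z g -> cont g z.
Proof.
  intros [g1 [H1 H2]] eps He.
  destruct (taylor_bounded _ _ _ H2) as [K [HK0 HK]].
  eapply near_imp;
    [|apply (near_and _ _ _ (near_and _ _ _ H1 HK) (near_ball z (eps / K)
             ltac:(apply Rdiv_lt_0_compat; assumption)))].
  intros y [[E1 E2] E3]; simpl in E1, E2, E3; rewrite E1.
  replace (g z + (y - z) * g1 y - g z)%C with ((y - z) * g1 y)%C by ring.
  rewrite Cmod_mult.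
  apply Rle_lt_trans with (Cmod (y - z) * K).
  - apply Rmult_le_compat_l; [apply Cmod_ge_0 | exact E2].
  - apply Rmult_lt_compat_r with (r := K) in E3; [|lra].
    replace (eps / K * K) with eps in E3 by (field; lra); exact E3.
Qed.

Lemma taylor_const (n : nat) : forall (z c : C), taylor n z (fun _ => c).
Proof.
  induction n; simpl; intros z c.
  - exists (Cmod c); apply near_true; intros; lra.
  - exists (fun _ => RtoC 0); split; [apply near_true; intros; ring | apply IHn].
Qed.

Lemma taylor_id (n : nat) (z : C) : taylor n z (fun y => y).
Proof.
  destruct n; simpl.
  - exists (Cmod z + 1); eapply near_imp; [|apply (near_ball z 1); lra].
    intros y Hy; simpl in Hy; pose proof (Cmod_le_plus_minus y z); lra.
  - exists (fun _ => RtoC 1); split; [apply near_true; intros; ring | apply taylor_const].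
Qed.

Lemma taylor_plus (n : nat) : forall (z : C) (f g : C -> C),
  taylor n z f -> taylor n z g -> taylor n z (fun y => f y + g y)%C.
Proof.
  induction n as [|n IH]; simpl; intros z f g.
  - intros [K HK] [L HL]; exists (K + L).
    eapply near_imp; [|apply (near_and _ _ _ HK HL)].
    intros y [E1 E2]; simpl in E1, E2.
    eapply Rle_trans; [apply Cmod_triangle | lra].
  - intros [f1 [F1 F2]] [g1 [G1 G2]].
    exists (fun y => f1 y + g1 y)%C; split; [|now apply IH].
    eapply near_imp; [|apply (near_and _ _ _ F1 G1)].
    intros y [E1 E2]; simpl in E1, E2; rewrite E1, E2; ring.
Qed.

(** Leibniz rule for divided differences: that of f g at z is g(z) f1 + f g1. The factor [f] itself
    is needed at order n, which [taylor_S] supplies. *)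
Lemma taylor_mult (n : nat) : forall (z : C) (f g : C -> C),
  taylor n z f -> taylor n z g -> taylor n z (fun y => f y * g y)%C.
Proof.
  induction n as [|n IH]; intros z f g.
  - intros [K HK] [L HL]; exists (K * L).
    eapply near_imp; [|apply (near_and _ _ _ HK HL)].
    intros y [E1 E2]; simpl in E1, E2; rewrite Cmod_mult.
    apply Rmult_le_compat; auto using Cmod_ge_0.
  - intros Hf Hg; pose proof (taylor_S _ _ _ Hf) as Hf'.
    destruct Hf as [f1 [F1 F2]], Hg as [g1 [G1 G2]].
    exists (fun y => g z * f1 y + f y * g1 y)%C; split.
    + eapply near_imp; [|apply (near_and _ _ _ F1 G1)].
      intros y [E1 E2]; simpl in E1, E2; rewrite E2, E1; ring.
    + apply taylor_plus; apply IH; auto using taylor_const.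
Qed.

Lemma taylor_opp (n : nat) (z : C) (g : C -> C) :
  taylor n z g -> taylor n z (fun y => - g y)%C.
Proof.
  intros H; apply taylor_ext with (fun y => (- RtoC 1) * g y)%C.
  - apply near_true; intros; ring.
  - apply taylor_mult; [apply taylor_const | exact H].
Qed.

Lemma taylor_minus (n : nat) (z : C) (f g : C -> C) :
  taylor n z f -> taylor n z g -> taylor n z (fun y => f y - g y)%C.
Proof. intros; apply taylor_plus; [|apply taylor_opp]; assumption. Qed.

Lemma cont_near_lower (g : C -> C) (z : C) :
  cont g z -> g z <> RtoC 0 -> near z (fun y => Cmod (g z) / 2 < Cmod (g y)).
Proof.
  intros Hc Hz; apply Cmod_gt_0 in Hz.
  eapply near_imp; [|apply (Hc (Cmod (g z) / 2)); lra].
  intros y Hy; simpl in Hy; rewrite Cmod_sym in Hy.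
  pose proof (Cmod_le_plus_minus (g z) (g y)); lra.
Qed.

Lemma taylor_inv (n : nat) : forall (z : C) (g : C -> C),
  cont g z -> g z <> RtoC 0 -> taylor n z g -> taylor n z (fun y => / g y)%C.
Proof.
  induction n as [|n IH]; intros z g Hc Hz Hg;
    pose proof (cont_near_lower g z Hc Hz) as Hl; pose proof Hz as Hz';
    apply Cmod_gt_0 in Hz'.
  - exists (/ (Cmod (g z) / 2)); eapply near_imp; [|apply Hl].
    intros y Hy; simpl in Hy.
    rewrite Cmod_inv by (apply Cmod_gt_0; lra).
    apply Rinv_le_contravar; lra.
  - pose proof (taylor_S _ _ _ Hg) as Hg'.
    destruct Hg as [g1 [G1 G2]].
    (* The divided difference of 1/g is -g1 / (g(z) g); it contains 1/g at one order less, which is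
       the induction hypothesis. *)
    exists (fun y => (- / g z) * (g1 y * / g y))%C; split.
    + eapply near_imp; [|apply (near_and _ _ _ G1 Hl)].
      intros y [E1 E2]; simpl in E1, E2.
      assert (g y <> RtoC 0) by (apply Cmod_gt_0; lra).
      assert (E3 : ((y - z) * g1 y = g y - g z)%C) by (rewrite E1; ring).
      replace ((y - z) * (- / g z * (g1 y * / g y)))%C
        with (((y - z) * g1 y) * (- / g z * / g y))%C by ring.
      rewrite E3; field; auto.
    + apply taylor_mult; [apply taylor_const|].
      apply taylor_mult; [exact G2 | now apply IH].
Qed.

(** Chain rule for divided differences: g1 times f1 o g. Continuity of [g] is a separate hypothesis
    because order 0 gives only boundedness. *)
Lemma taylor_comp (n : nat) : forall (z : C) (g f : C -> C),
  cont g z -> taylor n z g -> taylor n (g z) f -> taylor n z (fun y => f (g y)).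
Proof.
  induction n as [|n IH]; intros z g f Hc Hg Hf.
  - destruct Hf as [K HK]; exists K.
    exact (cont_comp_near g z (fun u => Cmod (f u) <= K) Hc HK).
  - pose proof (taylor_S _ _ _ Hg) as Hg'.
    destruct Hg as [g1 [G1 G2]], Hf as [f1 [F1 F2]].
    exists (fun y => g1 y * f1 (g y))%C; split.
    + pose proof (cont_comp_near g z _ Hc F1) as F1'.
      eapply near_imp; [|apply (near_and _ _ _ G1 F1')].
      intros y [E1 E2]; simpl in E1, E2; rewrite E2, E1 at 1; ring.
    + apply taylor_mult; [exact G2 | now apply IH].
Qed.

(* Bootstrapping: [v = p / (x o w)] is of order n as soon as w is, and
   [w y = w z + (y - z) v y] then gains one order. *)
Lemma taylor_inverse (n : nat) (z : C) (w p x : C -> C) :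
  cont w z -> (forall m, taylor m z p) -> (forall m, taylor m (w z) x) ->
  x (w z) <> RtoC 0 ->
  near z (fun y => (w y - w z) * x (w y) = (y - z) * p y)%C ->
  taylor n z w.
Proof.
  intros Hc Hp Hx Hx0 Heq.
  assert (Hcx : cont (fun y => x (w y)) z).
  { intros eps He.
    exact (cont_comp_near w z _ Hc (taylor_cont 0 _ _ (Hx 1%nat) eps He)). }
  induction n as [|n IH].
  - exists (Cmod (w z) + 1); eapply near_imp; [|apply (Hc 1); lra].
    intros y Hy; simpl in Hy; pose proof (Cmod_le_plus_minus (w y) (w z)); lra.
  - exists (fun y => p y * / x (w y))%C; split.
    + pose proof (cont_near_lower _ z Hcx Hx0) as Hl; simpl in Hl.
      pose proof (Cmod_ge_0 (x (w z))).
      eapply near_imp; [|apply (near_and _ _ _ Heq Hl)].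
      intros y [E1 E2]; simpl in E1, E2.
      assert (x (w y) <> RtoC 0) by (apply Cmod_gt_0; lra).
      replace ((y - z) * (p y * / x (w y)))%C
        with (((y - z) * p y) * / x (w y))%C by ring.
      rewrite <- E1; field; assumption.
    + apply taylor_mult; [apply Hp|].
      apply taylor_inv; [exact Hcx | exact Hx0|].
      apply taylor_comp; [exact Hc | exact IH | apply Hx].
Qed.

(** Stands in for analyticity. The expansions at different orders or points are not linked to each
    other; where a link is needed, it is proved by continuity. *)
Definition hol (g : C -> C) : Prop := forall z, inD z -> forall n, taylor n z g.

Lemma hol_cont (g : C -> C) (z : C) : hol g -> inD z -> cont g z.
Proof. intros H Hz; exact (taylor_cont 0 z g (H z Hz 1%nat)). Qed.

Lemma hol_const (c : C) : hol (fun _ => c).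
Proof. intros z _ n; apply taylor_const. Qed.

Lemma hol_plus (f g : C -> C) : hol f -> hol g -> hol (fun y => f y + g y)%C.
Proof. intros Hf Hg z Hz n; apply taylor_plus; auto. Qed.

Lemma hol_minus (f g : C -> C) : hol f -> hol g -> hol (fun y => f y - g y)%C.
Proof. intros Hf Hg z Hz n; apply taylor_minus; auto. Qed.

Lemma hol_mult (f g : C -> C) : hol f -> hol g -> hol (fun y => f y * g y)%C.
Proof. intros Hf Hg z Hz n; apply taylor_mult; auto. Qed.

Lemma hol_div (f g : C -> C) : hol f -> hol g ->
  (forall z, inD z -> g z <> RtoC 0) -> hol (fun y => f y / g y)%C.
Proof.
  intros Hf Hg H z Hz n; apply taylor_mult; [now apply Hf|].
  apply taylor_inv; auto using hol_cont.
Qed.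

(* [q 0] is chosen to be the coefficient that makes q continuous. *)
Lemma hol_quotient (g : C -> C) : hol g ->
  exists q, hol q /\ forall z, g z = (g (RtoC 0) + z * q z)%C.
Proof.
  intros Hg.
  assert (H0 : inD (RtoC 0)) by (unfold inD; rewrite Cmod_0; lra).
  destruct (Hg _ H0 2%nat) as [g1 [G1 G2]].
  pose (q := fun z => if excluded_middle_informative (z = RtoC 0) then g1 (RtoC 0)
                      else ((g z - g (RtoC 0)) / z)%C).
  exists q; split.
  - intros z Hz n.
    destruct (excluded_middle_informative (z = RtoC 0)) as [->|Hn].
    + destruct (Hg _ H0 (S (S n))) as [h1 [E1 E2]].
      apply taylor_ext with h1; [|now apply taylor_S].
      (* The expansions of orders 2 and n + 2 come with unrelated quotients [g1] and [h1]. Off 0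
         both equal (g y - g 0) / y, and both are continuous at 0, so they agree there: the value
         chosen for [q] at 0 fits every order. *)
      assert (Hh : g1 (RtoC 0) = h1 (RtoC 0)).
      { destruct (excluded_middle_informative (g1 (RtoC 0) = h1 (RtoC 0))) as [|Hd];
          [assumption|exfalso].
        assert (Hd' : 0 < Cmod (g1 (RtoC 0) - h1 (RtoC 0))).
        { apply Cmod_gt_0; intros E; apply Hd.
          replace (g1 (RtoC 0)) with (g1 (RtoC 0) - h1 (RtoC 0) + h1 (RtoC 0))%C by ring.
          rewrite E; ring. }
        set (e := Cmod (g1 (RtoC 0) - h1 (RtoC 0))) in *.
        pose proof (taylor_cont 0 _ _ G2 (e / 2) ltac:(lra)) as C1.
        pose proof (taylor_cont n _ _ E2 (e / 2) ltac:(lra)) as C2.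
        destruct (near_and _ _ _ (near_and _ _ _ G1 E1) (near_and _ _ _ C1 C2))
          as [d [Hd0 HH]].
        assert (Hy : Cmod (RtoC (d / 2) - RtoC 0) < d).
        { replace (RtoC (d / 2) - RtoC 0)%C with (RtoC (d / 2)) by ring.
          rewrite Cmod_R, Rabs_right; lra. }
        destruct (HH _ Hy) as [[A1 A2] [A3 A4]].
        assert (A5 : g1 (RtoC (d / 2)) = h1 (RtoC (d / 2))).
        { assert (Hne : RtoC (d / 2) <> RtoC 0) by (intros E; apply RtoC_inj in E; lra).
          assert (A6 : (RtoC (d / 2) * g1 (RtoC (d / 2)) = RtoC (d / 2) * h1 (RtoC (d / 2)))%C).
          { replace (RtoC (d / 2) * g1 (RtoC (d / 2)))%C with (g (RtoC (d / 2)) - g (RtoC 0))%C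
              by (rewrite A1; ring).
            rewrite A2 at 1; ring. }
          replace (g1 (RtoC (d / 2)))
            with (RtoC (d / 2) * g1 (RtoC (d / 2)) / RtoC (d / 2))%C by (field; auto).
          rewrite A6; field; auto. }
        rewrite A5 in A3; rewrite Cmod_sym in A3.
        unfold e in *.
        pose proof (Cmod_triangle (g1 (RtoC 0) - h1 (RtoC (d / 2)))
                      (h1 (RtoC (d / 2)) - h1 (RtoC 0))) as T.
        replace (g1 (RtoC 0) - h1 (RtoC (d / 2)) + (h1 (RtoC (d / 2)) - h1 (RtoC 0)))%C
          with (g1 (RtoC 0) - h1 (RtoC 0))%C in T by ring.
        lra. }
      eapply near_imp; [|apply E1].
      intros y Hy; simpl in Hy; unfold q.
      destruct (excluded_middle_informative (y = RtoC 0)) as [->|Hy0];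
        [now symmetry|].
      rewrite Hy; field; exact Hy0.
    + apply taylor_ext with (fun y => (g y - g (RtoC 0)) / y)%C.
      * exists (Cmod z); split; [now apply Cmod_gt_0|].
        intros y Hy; unfold q.
        destruct (excluded_middle_informative (y = RtoC 0)) as [->|]; [|reflexivity].
        replace (RtoC 0 - z)%C with (- z)%C in Hy by ring; rewrite Cmod_opp in Hy; lra.
      * apply taylor_mult.
        -- apply taylor_minus; [now apply Hg | apply taylor_const].
        -- apply taylor_inv; [exact (taylor_cont 0 z _ (taylor_id 1 z)) | exact Hn | apply taylor_id].
  - intros z; unfold q.
    destruct (excluded_middle_informative (z = RtoC 0)) as [->|Hn]; [ring|].
    field; exact Hn.
Qed.

(** A gauge form of compactness, obtained from the one for the enclosing square. Centres outside the
    disc get a radius of at most half their distance to it, so their cells cannot meet the disc.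
    Halving the radii absorbs the factor sqrt 2 < 2 between the sup norm and the modulus. *)
Lemma disc_cover (r : R) (delta : C -> posreal) :
  exists d, 0 < d /\ forall z, Cmod z <= r ->
    exists u, Cmod u <= r /\ Cmod (z - u) < delta u /\ d <= delta u.
Proof.
  assert (Hdel : forall z : C, exists e : posreal,
    (Cmod z <= r -> e <= delta z / 2) /\ (r < Cmod z -> e <= (Cmod z - r) / 2)).
  { intros z; destruct (Rle_lt_dec (Cmod z) r) as [H|H].
    - assert (Hp : 0 < delta z / 2) by (pose proof (cond_pos (delta z)); lra).
      exists (mkposreal _ Hp); split; simpl; intros; lra.
    - assert (Hp : 0 < (Cmod z - r) / 2) by lra.
      exists (mkposreal _ Hp); split; simpl; intros; lra. }
  pose (del := fun x y : R => proj1_sig (constructive_indefinite_description _ (Hdel (x, y)))).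
  destruct (compactness_value_2d (- r) r (- r) r del) as [d Hd].
  exists d; split; [apply cond_pos|].
  intros [x y] Hz.
  pose proof (Rle_trans _ _ _ (Rmax_Cmod (x, y)) Hz) as Hm; simpl in Hm.
  pose proof (Rle_trans _ _ _ (Rmax_l _ _) Hm) as Hx.
  pose proof (Rle_trans _ _ _ (Rmax_r _ _) Hm) as Hy.
  apply Rabs_le_between in Hx; apply Rabs_le_between in Hy.
  apply NNPP; intros Hno; apply (Hd x y Hx Hy).
  intros [u [v [_ [_ [H1 [H2 H3]]]]]]; apply Hno.
  assert (Hc : Cmod ((x, y) - (u, v)) < 2 * del u v).
  { eapply Rle_lt_trans; [apply Cmod_2Rmax|]; simpl.
    assert (Hs : sqrt 2 < 2).
    { rewrite <- (sqrt_square 2) at 2 by lra; apply sqrt_lt_1; lra. }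
    assert (Hmax : Rmax (Rabs (x + - u)) (Rabs (y + - v)) < del u v)
      by (apply Rmax_lub_lt; assumption).
    pose proof (Rabs_pos (x + - u)); pose proof (sqrt_pos 2).
    pose proof (Rmax_l (Rabs (x + - u)) (Rabs (y + - v))). nra. }
  unfold del in *.
  destruct (constructive_indefinite_description _ (Hdel (u, v))) as [e [He1 He2]]; simpl in *.
  exists (u, v).
  destruct (Rle_lt_dec (Cmod (u, v)) r) as [Hr|Hr].
  - specialize (He1 Hr); pose proof (cond_pos (delta (u, v))).
    split; [exact Hr|split; lra].
  - specialize (He2 Hr).
    rewrite Cmod_sym in Hc.
    pose proof (Cmod_le_plus_minus (u, v) (x, y)); lra.
Qed.

(** The hypothesis is upper semicontinuity. Each local bound is encoded in the radius of the gauge,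
    first as F <= 1/e, then as F <= M - e; the single [d] from [disc_cover] then gives a global
    bound, and next a gap below the supremum [M] if [M] is not attained. *)
Lemma disc_max (r : R) (F : C -> R) : 0 <= r ->
  (forall z, Cmod z <= r -> forall eps, 0 < eps ->
     near z (fun y => F y < F z + eps)) ->
  exists m, Cmod m <= r /\ forall z, Cmod z <= r -> F z <= F m.
Proof.
  intros Hr HF.
  assert (Hbd : exists B, forall z, Cmod z <= r -> F z <= B).
  { assert (Hdel : forall z : C, exists e : posreal, Cmod z <= r ->
      forall y, Cmod (y - z) < e -> F y <= / e).
    { intros z; destruct (Rle_lt_dec (Cmod z) r) as [H|H];
        [|exists (mkposreal 1 Rlt_0_1); intros; lra].
      destruct (HF z H 1 Rlt_0_1) as [d [Hd Hy]].
      pose proof (Rabs_pos (F z)); pose proof (Rle_abs (F z)).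
      assert (Hp : 0 < Rmin d (/ (Rabs (F z) + 1))).
      { apply Rmin_pos; [exact Hd|apply Rinv_0_lt_compat; lra]. }
      exists (mkposreal _ Hp); intros _ y Hyz; simpl in *.
      assert (F y < F z + 1) by (apply Hy; eapply Rlt_le_trans; [exact Hyz|apply Rmin_l]).
      apply Rle_trans with (/ / (Rabs (F z) + 1)); [rewrite Rinv_inv; lra|].
      apply Rinv_le_contravar; [exact Hp|apply Rmin_r]. }
    destruct (disc_cover r (fun z => proj1_sig (constructive_indefinite_description _ (Hdel z))))
      as [d [Hd Hc]].
    exists (/ d); intros z Hz; destruct (Hc z Hz) as [u [Hu [H1 H2]]].
    destruct (constructive_indefinite_description _ (Hdel u)) as [e He]; simpl in *.
    apply Rle_trans with (/ e); [now apply He|].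
    apply Rinv_le_contravar; assumption. }
  destruct (completeness (fun x => exists z, Cmod z <= r /\ x = F z)) as [M [HM1 HM2]].
  { destruct Hbd as [B HB]; exists B; intros x [z [Hz ->]]; now apply HB. }
  { exists (F (RtoC 0)), (RtoC 0); rewrite Cmod_0; auto. }
  apply NNPP; intros Hno.
  assert (Hlt : forall z, Cmod z <= r -> F z < M).
  { intros z Hz.
    assert (F z <= M) by (apply HM1; now exists z).
    destruct (Rlt_le_dec (F z) M) as [|Hle]; [assumption|exfalso].
    apply Hno; exists z; split; [exact Hz|]; intros y Hy.
    assert (F y <= M) by (apply HM1; now exists y); lra. }
  assert (Hdel : forall z : C, exists e : posreal, Cmod z <= r ->
    forall y, Cmod (y - z) < e -> F y <= M - e).
  { intros z; destruct (Rle_lt_dec (Cmod z) r) as [H|H];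
      [|exists (mkposreal 1 Rlt_0_1); intros; lra].
    specialize (Hlt z H).
    destruct (HF z H ((M - F z) / 2) ltac:(lra)) as [d [Hd Hy]].
    assert (Hp : 0 < Rmin d ((M - F z) / 2)) by (apply Rmin_pos; lra).
    exists (mkposreal _ Hp); intros _ y Hyz; simpl in *.
    assert (F y < F z + (M - F z) / 2)
      by (apply Hy; eapply Rlt_le_trans; [exact Hyz|apply Rmin_l]).
    pose proof (Rmin_r d ((M - F z) / 2)); lra. }
  destruct (disc_cover r (fun z => proj1_sig (constructive_indefinite_description _ (Hdel z))))
    as [d [Hd Hc]].
  assert (M <= M - d); [|lra].
  apply HM2; intros x [z [Hz ->]]; destruct (Hc z Hz) as [u [Hu [H1 H2]]].
  destruct (constructive_indefinite_description _ (Hdel u)) as [e He]; simpl in *.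
  specialize (He Hu z H1); lra.
Qed.

Lemma Cmod_sqr (z : C) : (Cmod z)² = (fst z)² + (snd z)².
Proof.
  unfold Cmod; rewrite Rsqr_sqrt; [unfold Rsqr; ring|].
  pose proof (pow2_ge_0 (fst z)); pose proof (pow2_ge_0 (snd z)); lra.
Qed.

Lemma Cmod_le_sqr (z : C) (B : R) : 0 <= B -> (fst z)² + (snd z)² <= B² -> Cmod z <= B.
Proof.
  intros HB H; rewrite <- Cmod_sqr in H.
  apply Rsqr_incr_0; auto using Cmod_ge_0.
Qed.

(* The square |x + e|^2 is dropped and 2 Re (conj a * e) bounded by Cauchy-Schwarz. *)
Lemma Cmod_sqr_plus_ge (a x e : C) (K : R) : Cmod e <= K ->
  (Cmod (a + (x + e)))² >=
    (Cmod a)² + 2 * (fst a * fst x + snd a * snd x) - 2 * (Cmod a * K).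
Proof.
  intros He.
  assert (H1 : Rabs (fst (Cconj a * e)%C) <= Cmod a * K).
  { eapply Rle_trans; [apply re_le_Cmod|].
    rewrite Cmod_mult, Cmod_conj.
    apply Rmult_le_compat_l; [apply Cmod_ge_0|exact He]. }
  apply Rabs_le_between in H1.
  rewrite !Cmod_sqr; destruct a as [a1 a2], x as [x1 x2], e as [e1 e2]; simpl in *.
  unfold Rsqr; pose proof (pow2_ge_0 (x1 + e1)); pose proof (pow2_ge_0 (x2 + e2)); lra.
Qed.

(* Averaging over m + h, m + i h, m - h, m - i h kills the linear and quadratic
   terms of the expansion of g, so the average of |g|^2 drops by at most O(h^3)
   while that of delta |z|^2 grows by delta h^2. *)
Lemma no_interior_max (g : C -> C) (m : C) (delta : R) :
  taylor 3 m g -> 0 < delta ->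
  ~ near m (fun y => (Cmod (g y))² + delta * (Cmod y)²
                     <= (Cmod (g m))² + delta * (Cmod m)²).
Proof.
  intros [g1 [G1 [g2 [G2 [g3 [G3 Hb]]]]]] Hdelta Hmax.
  destruct (taylor_bounded 0 _ _ Hb) as [K [HK0 HK]].
  destruct (near_and _ _ _ (near_and _ _ _ Hmax HK)
    (near_and _ _ _ G1 (near_and _ _ _ G2 G3))) as [d [Hd HH]].
  set (p := g1 m) in *; set (q := g2 m) in *; set (a := g m) in *.
  pose proof (Cmod_ge_0 a) as Ha.
  (* The first bound keeps the four test points inside the neighbourhood; the second makes 2 |a| K h
     < delta, so the cubic error loses against the quadratic gain. The + 1 covers the case g m =
     0. *)
  set (h := Rmin (d / 2) (delta / (4 * (Cmod a + 1) * K))).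
  assert (Hh0 : 0 < h).
  { apply Rmin_pos; [lra|]; apply Rdiv_lt_0_compat; nra. }
  assert (Hhd : h < d) by (unfold h; pose proof (Rmin_l (d / 2) (delta / (4 * (Cmod a + 1) * K))); lra).
  assert (Hhk : h * (4 * (Cmod a + 1) * K) <= delta).
  { unfold h; apply Rle_trans with (delta / (4 * (Cmod a + 1) * K) * (4 * (Cmod a + 1) * K)).
    - apply Rmult_le_compat_r; [nra|apply Rmin_r].
    - right; field; split; nra. }
  assert (Key : forall k : C, Cmod k = h ->
    delta * ((Cmod (m + k))² - (Cmod m)²)
      <= - 2 * (fst a * fst (k * p + k * k * q)%C + snd a * snd (k * p + k * k * q)%C)
         + 2 * (Cmod a * (h * h * h * K))).
  { intros k Hk.
    destruct (HH (m + k)%C) as [[A1 A2] [A3 [A4 A5]]].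
    { replace (m + k - m)%C with k by ring; lra. }
    simpl in A1.
    replace (m + k - m)%C with k in A3, A4, A5 by ring.
    rewrite A5 in A4; rewrite A4 in A3.
    assert (HE : Cmod (k * k * k * g3 (m + k))%C <= h * h * h * K).
    { rewrite !Cmod_mult, Hk; apply Rmult_le_compat_l; [|exact A2].
      apply Rmult_le_pos; nra. }
    pose proof (Cmod_sqr_plus_ge a (k * p + k * k * q)%C _ _ HE) as L.
    replace (a + (k * p + k * k * q + k * k * k * g3 (m + k)%C))%C
      with (g (m + k)%C) in L by (rewrite A3; ring).
    lra. }
  pose proof (Key (RtoC h) ltac:(rewrite Cmod_R, Rabs_right; lra)) as K1.
  pose proof (Key (RtoC (- h)) ltac:(rewrite Cmod_R, Rabs_left; lra)) as K2.
  pose proof (Key (Ci * RtoC h)%C ltac:(rewrite Cmod_mult, Cmod_Ci, Cmod_R, Rabs_right; lra)) as K3.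
  pose proof (Key (Ci * RtoC (- h))%C ltac:(rewrite Cmod_mult, Cmod_Ci, Cmod_R, Rabs_left; lra)) as K4.
  rewrite !Cmod_sqr in K1, K2, K3, K4.
  set (ca := Cmod a) in *.
  assert (Hfin : 4 * delta * (h * h) <= 8 * (ca * (h * h * h * K))).
  { clearbody ca; clear -K1 K2 K3 K4.
    destruct m as [m1 m2], p as [p1 p2], q as [q1 q2], a as [a1 a2].
    simpl in *; unfold Rsqr in *; lra. }
  assert (0 < h * h) by nra.
  assert (ca * h * K * 2 < delta) by nra.
  nra.
Qed.

Lemma maximum_principle (g : C -> C) (r B : R) : hol g -> 0 <= r < 1 -> 0 <= B ->
  (forall z, Cmod z = r -> Cmod (g z) <= B) ->
  forall z, Cmod z <= r -> Cmod (g z) <= B.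
Proof.
  intros Hg Hr HB Hbd z1 Hz1.
  destruct (Rle_lt_dec (Cmod (g z1)) B) as [|Hlt]; [assumption|exfalso].
  (* Half of the excess: on the boundary circle |g|^2 + delta |z|^2 is at most B^2 + delta, below
     the value at [z1], which is at least B^2 + 2 delta. The maximum is thus interior, against
     [no_interior_max]. *)
  set (delta := ((Cmod (g z1))² - B²) / 2).
  assert (Hd : 0 < delta) by (unfold delta, Rsqr; nra).
  destruct (disc_max r (fun y => (Cmod (g y))² + delta * (Cmod y)²)) as [m [Hm Hmax]];
    [lra| |].
  - intros z Hz eps Heps.
    assert (Hz' : inD z) by (unfold inD; lra).
    pose proof (Cmod_ge_0 (g z)) as P1; pose proof (Cmod_ge_0 z) as P2.
    set (s := Rmin 1 (eps / (2 * ((2 * Cmod (g z) + 1) + delta * (2 * Cmod z + 1))))).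
    assert (Hden : 0 < 2 * ((2 * Cmod (g z) + 1) + delta * (2 * Cmod z + 1))) by nra.
    assert (Hs0 : 0 < s) by (apply Rmin_pos; [lra|apply Rdiv_lt_0_compat; assumption]).
    assert (Hs1 : s <= 1) by apply Rmin_l.
    assert (Hs2 : s * (2 * ((2 * Cmod (g z) + 1) + delta * (2 * Cmod z + 1))) <= eps).
    { apply Rle_trans with (eps / (2 * ((2 * Cmod (g z) + 1) + delta * (2 * Cmod z + 1)))
        * (2 * ((2 * Cmod (g z) + 1) + delta * (2 * Cmod z + 1)))).
      - apply Rmult_le_compat_r; [lra|apply Rmin_r].
      - right; field; lra. }
    eapply near_imp; [|apply (near_and _ _ _ (hol_cont g z Hg Hz' s Hs0) (near_ball z s Hs0))].
    intros y [E1 E2]; simpl in E1, E2.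
    pose proof (Cmod_le_plus_minus (g y) (g z)); pose proof (Cmod_le_plus_minus y z).
    pose proof (Cmod_ge_0 (g y)); pose proof (Cmod_ge_0 y).
    assert (B1 : (Cmod (g y))² <= (Cmod (g z))² + s * (2 * Cmod (g z) + 1)).
    { unfold Rsqr; apply Rle_trans with ((Cmod (g z) + s) * (Cmod (g z) + s)); nra. }
    assert (B2 : (Cmod y)² <= (Cmod z)² + s * (2 * Cmod z + 1)).
    { unfold Rsqr; apply Rle_trans with ((Cmod z + s) * (Cmod z + s)); nra. }
    apply (Rmult_le_compat_l delta) in B2; [|lra]; nra.
  - pose proof (Hmax z1 Hz1) as H1; simpl in H1.
    destruct (Rle_lt_or_eq_dec _ _ Hm) as [Hmr|Hmr].
    + apply (no_interior_max g m delta); [apply Hg; unfold inD; lra|exact Hd|].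
      exists (r - Cmod m); split; [lra|]; intros y Hy.
      apply Hmax; pose proof (Cmod_le_plus_minus y m); lra.
    + specialize (Hbd m Hmr); pose proof (Cmod_ge_0 (g m)).
      assert ((Cmod (g m))² <= B²) by (unfold Rsqr; nra).
      assert ((Cmod m)² <= 1) by (rewrite Hmr; unfold Rsqr; nra).
      assert (0 <= (Cmod z1)²) by apply Rle_0_sqr.
      unfold delta in *; nra.
Qed.

(** The maximum principle on |z| = r gives |q| <= k / r, and r tends to 1. A general [k] is kept
    because the Schur algorithm needs bounds strictly below 1. *)
Lemma schwarz (g : C -> C) (k : R) : hol g -> 0 <= k ->
  (forall z, inD z -> Cmod (g z) <= k) -> g (RtoC 0) = RtoC 0 ->
  exists q, hol q /\ (forall z, g z = (z * q z)%C) /\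
    forall z, inD z -> Cmod (q z) <= k.
Proof.
  intros Hg Hk Hb H0; destruct (hol_quotient g Hg) as [q [Hq E]].
  exists q; split; [exact Hq|].
  assert (E' : forall z, g z = (z * q z)%C) by (intros z; rewrite E, H0; ring).
  split; [exact E'|]; intros z Hz; unfold inD in *.
  pose proof (Cmod_ge_0 z).
  destruct (Rle_lt_dec (Cmod (q z)) k) as [|Hlt]; [assumption|exfalso].
  assert (Hall : forall r, Cmod z <= r -> 0 < r < 1 -> r * Cmod (q z) <= k).
  { intros r Hr1 Hr2.
    assert (M : Cmod (q z) <= k / r).
    { apply (maximum_principle q r); auto; try lra.
      - apply Rmult_le_pos; [lra|]; apply Rlt_le, Rinv_0_lt_compat; lra.
      - intros y Hy; specialize (Hb y ltac:(lra)); rewrite E', Cmod_mult, Hy in Hb.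
        apply Rmult_le_reg_l with r; [lra|].
        replace (r * (k / r)) with k by (field; lra); exact Hb. }
    apply Rmult_le_compat_l with (r := r) in M; [|lra].
    replace (r * (k / r)) with k in M by (field; lra); exact M. }
  (* A radius past the midpoint of k / |q z| and 1, so that t |q z| is at least (k + |q z|) / 2 >
     k. *)
  set (t := Rmax (Cmod z) ((k / Cmod (q z) + 1) / 2)).
  assert (Hq1 : k / Cmod (q z) < 1).
  { apply Rmult_lt_reg_r with (Cmod (q z)); [lra|].
    replace (k / Cmod (q z) * Cmod (q z)) with k by (field; lra); lra. }
  assert (Hq0 : 0 <= k / Cmod (q z)).
  { apply Rmult_le_pos; [lra|]; apply Rlt_le, Rinv_0_lt_compat; lra. }
  assert (Ht : 0 < t < 1).
  { split; [eapply Rlt_le_trans; [|apply Rmax_r]; lra|apply Rmax_lub_lt; lra]. }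
  pose proof (Hall t (Rmax_l _ _) Ht) as F.
  assert (G : (k / Cmod (q z) + 1) / 2 <= t) by apply Rmax_r.
  apply Rmult_le_compat_r with (r := Cmod (q z)) in G; [|lra].
  replace ((k / Cmod (q z) + 1) / 2 * Cmod (q z)) with ((k + Cmod (q z)) / 2) in G
    by (field; lra).
  lra.
Qed.

(** * Schur parameters and the coefficient functionals *)

(** From 1 - |(a - b) / (1 - conj b a)|^2 = (1 - |a|^2) (1 - |b|^2) / |1 - conj b a|^2, with
    numerator at least (1 - r^2)^2 and denominator at most 4. The bound is uniform and below 1, so
    the next Schur function again stays away from the unit circle. *)
Lemma moebius_bound (a b : C) (r : R) : 0 <= r < 1 -> Cmod a <= r -> Cmod b <= r ->
  (1 - Cconj b * a)%C <> RtoC 0 /\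
  Cmod ((a - b) / (1 - Cconj b * a)) <= sqrt (1 - (1 - r²)² / 4).
Proof.
  intros Hr Ha Hb.
  pose proof (Cmod_ge_0 a) as Ha0; pose proof (Cmod_ge_0 b) as Hb0.
  assert (Hba : Cmod (Cconj b * a) <= r * r)
    by (rewrite Cmod_mult, Cmod_conj; apply Rmult_le_compat; lra).
  assert (H0 : (1 - Cconj b * a)%C <> RtoC 0).
  { intros E.
    assert (E' : (Cconj b * a = 1)%C) by (rewrite <- (Cplus_0_r (Cconj b * a)), <- E; ring).
    rewrite E', Cmod_1 in Hba; nra. }
  split; [exact H0|].
  rewrite Cmod_div by exact H0.
  set (D := Cmod (1 - Cconj b * a)%C).
  assert (HD : 0 < D) by now apply Cmod_gt_0.
  assert (HD2 : D <= 2).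
  { unfold D, Cminus; eapply Rle_trans; [apply Cmod_triangle|].
    rewrite Cmod_1, Cmod_opp; nra. }
  assert (Hid : D² - (Cmod (a - b))² = (1 - (Cmod a)²) * (1 - (Cmod b)²)).
  { unfold D; rewrite !Cmod_sqr; destruct a, b; simpl; unfold Rsqr; ring. }
  rewrite <- (sqrt_Rsqr (Cmod (a - b) / D))
    by (apply Rmult_le_pos; [apply Cmod_ge_0|now apply Rlt_le, Rinv_0_lt_compat]).
  apply sqrt_le_1_alt.
  replace ((Cmod (a - b) / D)²) with (1 - (1 - (Cmod a)²) * (1 - (Cmod b)²) / D²)
    by (rewrite <- Hid; unfold Rsqr; field; lra).
  assert (A1 : 1 - r² <= 1 - (Cmod a)²) by (unfold Rsqr; nra).
  assert (A2 : 1 - r² <= 1 - (Cmod b)²) by (unfold Rsqr; nra).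
  assert (A0 : 0 < 1 - r²) by (unfold Rsqr; nra).
  assert (A3 : (1 - r²)² <= (1 - (Cmod a)²) * (1 - (Cmod b)²)) by (unfold Rsqr at 1; nra).
  assert (A4 : / 4 <= / D²) by (apply Rinv_le_contravar; unfold Rsqr; nra).
  unfold Rdiv; apply Rplus_le_compat_l, Ropp_le_contravar.
  apply Rmult_le_compat; [apply Rle_0_sqr|lra|exact A3|exact A4].
Qed.

Lemma inD_0 : inD (RtoC 0).
Proof. unfold inD; rewrite Cmod_0; lra. Qed.

(** The Schwarz lemma for the Moebius transform of [f] that sends f(0) to 0. The conclusion is
    cleared of its denominator so that consecutive steps combine as ring identities. *)
Lemma schur_step (f : C -> C) (r : R) : hol f -> 0 <= r < 1 ->
  (forall z, inD z -> Cmod (f z) <= r) ->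
  exists q k, 0 <= k < 1 /\ hol q /\ (forall z, inD z -> Cmod (q z) <= k) /\
    forall z, inD z ->
      (f z = f (RtoC 0) + z * q z * (1 - Cconj (f (RtoC 0)) * f z))%C.
Proof.
  intros Hf Hr Hb; set (b := f (RtoC 0)).
  assert (Hbb : Cmod b <= r) by (apply Hb, inD_0).
  pose proof (fun z Hz => moebius_bound (f z) b r Hr (Hb z Hz) Hbb) as HM.
  assert (Hq : 0 < (1 - r²)² / 4 <= 1).
  { assert (0 < 1 - r² <= 1) by (unfold Rsqr; nra); unfold Rsqr at 1 3; nra. }
  assert (Hden : hol (fun z => 1 - Cconj b * f z)%C)
    by (apply hol_minus; [|apply hol_mult]; auto using hol_const).
  destruct (schwarz (fun z => (f z - b) / (1 - Cconj b * f z))%C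
              (sqrt (1 - (1 - r²)² / 4))) as [q [Q1 [Q2 Q3]]].
  - apply hol_div; [apply hol_minus; auto using hol_const|exact Hden|].
    intros z Hz; apply (HM z Hz).
  - apply sqrt_pos.
  - intros z Hz; apply (HM z Hz).
  - unfold b; replace (f (RtoC 0) - f (RtoC 0))%C with (RtoC 0) by ring.
    unfold Cdiv; ring.
  - exists q, (sqrt (1 - (1 - r²)² / 4)); split.
    { split; [apply sqrt_pos|].
      apply Rlt_le_trans with (sqrt 1); [apply sqrt_lt_1; lra|rewrite sqrt_1; lra]. }
    split; [exact Q1|split; [exact Q3|]].
    intros z Hz; rewrite <- Q2; destruct (HM z Hz) as [H0 _]; field; exact H0.
Qed.

(* c, g, d are the Schur parameters of r w; the factor r < 1 keeps them inside the
   open disc, so that the algorithm does not stop. *)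
Lemma schwarz_coefficients (w : C -> C) (r : R) : hol w ->
  (forall z, inD z -> Cmod (w z) <= 1) -> w (RtoC 0) = RtoC 0 -> 0 <= r < 1 ->
  exists c g d psi, Cmod c <= 1 /\ Cmod g <= 1 /\ Cmod d <= 1 /\ hol psi /\
    psi (RtoC 0) = ((1 - c * Cconj c) * ((1 - g * Cconj g) * d - Cconj c * (g * g)))%C /\
    forall z, inD z ->
      (RtoC r * w z = z * (c + z * ((1 - c * Cconj c) * g + z * psi z)))%C.
Proof.
  intros Hw Hb H0 Hr.
  destruct (schwarz w 1 Hw ltac:(lra) Hb H0) as [f [F1 [F2 F3]]].
  set (f1 := fun z => (RtoC r * f z)%C).
  assert (B1 : forall z, inD z -> Cmod (f1 z) <= r).
  { intros z Hz; unfold f1; rewrite Cmod_mult, Cmod_R, Rabs_right by lra.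
    specialize (F3 z Hz); nra. }
  assert (H1 : hol f1) by (apply hol_mult; auto using hol_const).
  destruct (schur_step f1 r H1 Hr B1) as [f2 [k [Hk [H2 [B2 E2]]]]].
  destruct (schur_step f2 k H2 Hk B2) as [f3 [l [Hl [H3 [B3 E3]]]]].
  set (c := f1 (RtoC 0)) in *; set (g := f2 (RtoC 0)) in *; set (d := f3 (RtoC 0)).
  (* Found by expanding f1 = c + z f2 (1 - conj c f1) once more: f2 (1 - conj c f1) - (1 - |c|^2) g
     equals (1 - conj c f1) (f2 - g) - g conj c (f1 - c), and both differences carry a factor z. *)
  exists c, g, d, (fun z => (1 - Cconj c * f1 z) *
     (f3 z * (1 - Cconj g * f2 z) - g * Cconj c * f2 z))%C.
  split; [eapply Rle_trans; [apply B1, inD_0|lra]|].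
  split; [eapply Rle_trans; [apply B2, inD_0|lra]|].
  split; [eapply Rle_trans; [apply B3, inD_0|lra]|].
  split; [|split].
  - apply hol_mult.
    + apply hol_minus; [|apply hol_mult]; auto using hol_const.
    + apply hol_minus; apply hol_mult; auto using hol_const.
      apply hol_minus; [|apply hol_mult]; auto using hol_const.
  - fold c g d; ring.
  - intros z Hz; rewrite F2.
    replace (RtoC r * (z * f z))%C with (z * f1 z)%C by (unfold f1; ring).
    f_equal; pose proof (E2 z Hz) as P; pose proof (E3 z Hz) as Q.
    generalize dependent (f1 z); generalize dependent (f2 z);
      generalize dependent (f3 z); clearbody c g; clear; intros u3 u2 Q u1 P.
    assert (Q' : (z * u3 * (1 - Cconj g * u2) = u2 - g)%C) by (rewrite Q at 2; ring).
    assert (P' : (z * u2 * (1 - Cconj c * u1) = u1 - c)%C) by (rewrite P at 2; ring).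
    replace (c + z * ((1 - c * Cconj c) * g + z * ((1 - Cconj c * u1) *
       (u3 * (1 - Cconj g * u2) - g * Cconj c * u2))))%C
    with (c + z * (1 - c * Cconj c) * g + z * (1 - Cconj c * u1) * (z * u3 * (1 - Cconj g * u2))
      - z * g * Cconj c * (z * u2 * (1 - Cconj c * u1)))%C by ring.
    rewrite Q', P'.
    transitivity (c + z * u2 * (1 - Cconj c * u1))%C; [rewrite P'|]; ring.
Qed.

Lemma conj_defect (z : C) : (1 - z * Cconj z)%C = RtoC (1 - (Cmod z)²).
Proof.
  rewrite Cmod_sqr; destruct z as [x y]; unfold RtoC, Cconj, Cmult, Cminus, Copp, Cplus, Rsqr; simpl.
  f_equal; ring.
Qed.

Lemma defect_range (z : C) : Cmod z <= 1 -> 0 <= 1 - (Cmod z)² <= 1.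
Proof. intros H; pose proof (Cmod_ge_0 z); unfold Rsqr; nra. Qed.

Lemma second_functional_bound (c g : C) : Cmod c <= 1 -> Cmod g <= 1 ->
  Cmod (RtoC 2 * (c * c) + (1 - c * Cconj c) * g) <= 2.
Proof.
  intros Hc Hg.
  eapply Rle_trans; [apply Cmod_triangle|].
  rewrite conj_defect, !Cmod_mult, !Cmod_R.
  pose proof (defect_range c Hc); pose proof (Cmod_ge_0 g); pose proof (Cmod_ge_0 c).
  rewrite (Rabs_right 2), (Rabs_right (1 - _)) by lra.
  unfold Rsqr in *; nra.
Qed.

(* With p = |c|^2, D = 1 - p, t = |g|^2, the defect in
   |al c^3 + D (be c g - conj c g^2)|^2 <= (al p + D t)^2 (p + be^2 D / (4 al))
   is the square D (4 al Re (g conj c^2) - be (al p - D t))^2 / (4 al). *)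
Lemma third_functional_bound (c g d : C) : Cmod c <= 1 -> Cmod g <= 1 -> Cmod d <= 1 ->
  Cmod ((1 - c * Cconj c) * ((1 - g * Cconj g) * d - Cconj c * (g * g))
        + RtoC (7 / 2) * (c * ((1 - c * Cconj c) * g)) + RtoC (17 / 6) * (c * c * c)) <= 17 / 6.
Proof.
  intros Hc Hg Hd.
  set (p := (Cmod c)²); set (t := (Cmod g)²).
  pose proof (defect_range c Hc) as Hp; pose proof (defect_range g Hg) as Ht.
  fold p in Hp; fold t in Ht.
  rewrite !conj_defect; fold p t.
  replace (RtoC (1 - p) * (RtoC (1 - t) * d - Cconj c * (g * g)) +
     RtoC (7 / 2) * (c * (RtoC (1 - p) * g)) + RtoC (17 / 6) * (c * c * c))%C
    with ((RtoC (17 / 6) * (c * c * c) +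
            RtoC (1 - p) * (RtoC (7 / 2) * (c * g) - Cconj c * (g * g)))
          + RtoC (1 - p) * (RtoC (1 - t) * d))%C by ring.
  eapply Rle_trans; [apply Cmod_triangle|].
  assert (H1 : Cmod (RtoC (1 - p) * (RtoC (1 - t) * d)) <= (1 - p) * (1 - t)).
  { rewrite !Cmod_mult, !Cmod_R, (Rabs_right (1 - p)), (Rabs_right (1 - t)) by lra.
    pose proof (Cmod_ge_0 d); apply Rmult_le_compat_l; nra. }
  (* With al = 17/6 and be = 7/2, be^2 / (4 al) = 147/136, so p + 147/136 (1 - p) = 1 + 11/136 (1 -
     p). The constant 11/272 is half of 11/136, from sqrt (1 + x) <= 1 + x/2. *)
  assert (H2 : Cmod (RtoC (17 / 6) * (c * c * c) +
            RtoC (1 - p) * (RtoC (7 / 2) * (c * g) - Cconj c * (g * g)))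
          <= (17 / 6 * p + (1 - p) * t) * (1 + 11 / 272 * (1 - p))).
  { apply Cmod_le_sqr; [apply Rmult_le_pos; nra|].
    apply Rle_trans with ((17 / 6 * p + (1 - p) * t)² * (p + 147 / 136 * (1 - p))).
    - set (V := fst (g * Cconj (c * c))%C).
      apply Rminus_le_0.
      replace ((17 / 6 * p + (1 - p) * t)² * (p + 147 / 136 * (1 - p)) - _)
        with ((1 - p) * (34 / 3 * V - 7 / 2 * (17 / 6 * p - (1 - p) * t))² * (3 / 34)).
      { apply Rmult_le_pos; [apply Rmult_le_pos; [lra|apply Rle_0_sqr]|lra]. }
      generalize (1 - p); intros D; unfold V, p, t; rewrite !Cmod_sqr.
      destruct c as [x y], g as [u v]; simpl; unfold Rsqr; field.
    - rewrite Rsqr_mult; apply Rmult_le_compat_l; [apply Rle_0_sqr|].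
      unfold Rsqr; nra. }
  eapply Rle_trans; [apply Rplus_le_compat; [exact H2|exact H1]|].
  (* With D = 1 - p the terms D t cancel in the sum, which is 17/6 - 11/6 D + 11/272 D (17/6 p + D
     t); the last bracket is small enough for the negative term to win. *)
  assert (Htp : t * (1 - p) <= 1) by nra.
  assert ((1 - p) * (t * (1 - p)) <= (1 - p) * 1) by (apply Rmult_le_compat_l; lra).
  nra.
Qed.

(** * Power series on the unit disc *)

Lemma is_series_lin (u v : nat -> R) (x y lu lv : R) :
  is_series u lu -> is_series v lv ->
  is_series (fun n => x * u n + y * v n) (x * lu + y * lv).
Proof.
  intros Hu Hv.
  exact (is_series_plus _ _ _ _ (is_series_scal_l x u lu Hu) (is_series_scal_l y v lv Hv)).
Qed.

Lemma is_series_incr_iff (u : nat -> R) (l : R) :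
  is_series u l <-> is_series (fun n => u (S n)) (l - u 0%nat).
Proof.
  split; intros H.
  - apply is_series_incr_1.
    match goal with |- is_series _ ?x => replace x with l; [exact H|] end.
    unfold plus; simpl; ring.
  - apply is_series_decr_1; exact H.
Qed.

(** Componentwise, like [Csin], so that comparison tests and Cauchy products of real series apply;
    [csum_is_series] links it to convergence in [C_NormedModule]. *)
Definition csum (u : nat -> C) (l : C) : Prop :=
  is_series (fun n => fst (u n)) (fst l) /\ is_series (fun n => snd (u n)) (snd l).

Lemma csum_ext (u v : nat -> C) (l : C) : (forall n, u n = v n) -> csum u l -> csum v l.
Proof.
  intros E [H1 H2]; split; [eapply is_series_ext; [|exact H1] | eapply is_series_ext; [|exact H2]];
    intros n; simpl; now rewrite E.
Qed.

Lemma csum_plus (u v : nat -> C) (l m : C) :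
  csum u l -> csum v m -> csum (fun n => u n + v n)%C (l + m)%C.
Proof. intros [H1 H2] [H3 H4]; split; simpl.
  - exact (is_series_plus _ _ _ _ H1 H3).
  - exact (is_series_plus _ _ _ _ H2 H4).
 Qed.

Lemma csum_scal (c : C) (u : nat -> C) (l : C) :
  csum u l -> csum (fun n => c * u n)%C (c * l)%C.
Proof.
  intros [H1 H2]; split; simpl.
  - replace (fst c * fst l - snd c * snd l) with (fst c * fst l + (- snd c) * snd l) by ring.
    eapply is_series_ext; [|apply is_series_lin; [exact H1|exact H2]].
    intros n; simpl; ring.
  - apply is_series_lin; assumption.
Qed.

Lemma csum_incr (u : nat -> C) (l : C) :
  csum u l <-> csum (fun n => u (S n)) (l - u 0%nat)%C.
Proof. unfold csum; simpl; now rewrite (is_series_incr_iff _ (fst l)), (is_series_incr_iff _ (snd l)). Qed.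

Lemma ex_series_Rabs_le (u b : nat -> R) :
  (forall n, Rabs (u n) <= b n) -> ex_series b -> ex_series u.
Proof. intros H Hb; apply (@ex_series_le R_AbsRing R_CompleteNormedModule u b); auto. Qed.

Lemma im_le_Cmod (c : C) : Rabs (snd c) <= Cmod c.
Proof. eapply Rle_trans; [apply Rmax_r|apply Rmax_Cmod]. Qed.

Lemma csum_abs (u : nat -> C) (b : nat -> R) :
  (forall n, Cmod (u n) <= b n) -> ex_series b ->
  csum u (Series (fun n => fst (u n)), Series (fun n => snd (u n))).
Proof.
  intros H Hb; split; apply Series_correct; apply ex_series_Rabs_le with b; auto; intros n;
    (eapply Rle_trans; [|apply H]); [apply re_le_Cmod|apply im_le_Cmod].
Qed.

(* |l|^2 is the sum of the Re (conj l * u n), each at most |l| |u n|. *)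
Lemma csum_norm_le (u : nat -> C) (b : nat -> R) (l : C) :
  csum u l -> (forall n, Cmod (u n) <= b n) -> ex_series b -> Cmod l <= Series b.
Proof.
  intros H Hb Eb.
  destruct (csum_scal (Cconj l) _ _ H) as [H1 _].
  pose proof (Cmod_ge_0 l) as Hl.
  assert (Hle : Cmod l * Cmod l <= Cmod l * Series b).
  { replace (Cmod l * Cmod l) with (fst (Cconj l * l)%C).
    2:{ pose proof (Cmod_sqr l) as E; unfold Rsqr in E; rewrite E; destruct l; simpl; ring. }
    rewrite <- (is_series_unique _ _ H1).
    rewrite <- Series_scal_l.
    assert (Hab : forall n, Rabs (fst (Cconj l * u n)%C) <= Cmod l * b n).
    { intros n; eapply Rle_trans; [apply re_le_Cmod|].
      rewrite Cmod_mult, Cmod_conj; now apply Rmult_le_compat_l. }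
    assert (Ex : ex_series (fun n => Cmod l * b n)) by now apply (ex_series_scal_l (Cmod l) b).
    assert (Ea : ex_series (fun n => Rabs (fst (Cconj l * u n)%C))).
    { apply ex_series_Rabs_le with (fun n => Cmod l * b n); [|exact Ex].
      intros n; now rewrite Rabs_Rabsolu. }
    eapply Rle_trans; [apply Rle_abs|].
    eapply Rle_trans; [apply Series_Rabs, Ea|].
    apply Series_le; [|exact Ex]; intros n; split; [apply Rabs_pos|apply Hab]. }
  destruct (Rle_lt_or_eq_dec _ _ Hl) as [Hp|Hz].
  - apply Rmult_le_reg_l with (Cmod l); assumption.
  - rewrite <- Hz.
    replace 0 with (Series (fun _ : nat => 0)).
    + apply Series_le; [|exact Eb].
      intros n; split; [lra|]; eapply Rle_trans; [apply Cmod_ge_0|apply Hb].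
    + rewrite (Series_ext _ (fun n => 0 * b n)) by (intros; ring).
      rewrite Series_scal_l; ring.
Qed.

Definition conv (u v : nat -> C) (n : nat) : C :=
  sum_n (G := C_NormedModule) (fun k => u k * v (n - k)%nat)%C n.

Lemma csum_mult (u v : nat -> C) (l m : C) : csum u l -> csum v m ->
  ex_series (fun n => Cmod (u n)) -> ex_series (fun n => Cmod (v n)) ->
  csum (conv u v) (l * m)%C.
Proof.
  intros [U1 U2] [V1 V2] Eu Ev.
  assert (A1 : forall w : nat -> C, ex_series (fun n => Cmod (w n)) ->
    ex_series (fun n => Rabs (fst (w n)))).
  { intros w Hw; apply ex_series_Rabs_le with (fun n => Cmod (w n)); [|exact Hw].
    intros n; rewrite Rabs_Rabsolu; apply re_le_Cmod. }
  assert (A2 : forall w : nat -> C, ex_series (fun n => Cmod (w n)) ->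
    ex_series (fun n => Rabs (snd (w n)))).
  { intros w Hw; apply ex_series_Rabs_le with (fun n => Cmod (w n)); [|exact Hw].
    intros n; rewrite Rabs_Rabsolu; apply im_le_Cmod. }
  pose proof (is_series_mult _ _ _ _ U1 V1 (A1 u Eu) (A1 v Ev)) as M11.
  pose proof (is_series_mult _ _ _ _ U2 V2 (A2 u Eu) (A2 v Ev)) as M22.
  pose proof (is_series_mult _ _ _ _ U1 V2 (A1 u Eu) (A2 v Ev)) as M12.
  pose proof (is_series_mult _ _ _ _ U2 V1 (A2 u Eu) (A1 v Ev)) as M21.
  (* The upper limit [N] is separated from the [n] inside [n - k]; otherwise the induction would
     change every summand. *)
  assert (S1 : forall n N, sum_f_R0 (fun k => fst (u k) * fst (v (n - k)%nat)) N +
     -1 * sum_f_R0 (fun k => snd (u k) * snd (v (n - k)%nat)) N =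
     fst (sum_n (G := C_NormedModule) (fun k => u k * v (n - k)%nat)%C N)).
  { intros n; induction N as [|N IH].
    - rewrite sum_O; simpl; ring.
    - rewrite sum_Sn.
      match goal with |- _ = fst (plus ?x ?y) => change (fst (plus x y)) with (fst x + fst y) end.
      rewrite <- IH; simpl; ring. }
  assert (S2 : forall n N, sum_f_R0 (fun k => fst (u k) * snd (v (n - k)%nat)) N +
     sum_f_R0 (fun k => snd (u k) * fst (v (n - k)%nat)) N =
     snd (sum_n (G := C_NormedModule) (fun k => u k * v (n - k)%nat)%C N)).
  { intros n; induction N as [|N IH].
    - rewrite sum_O; simpl; ring.
    - rewrite sum_Sn.
      match goal with |- _ = snd (plus ?x ?y) => change (snd (plus x y)) with (snd x + snd y) end.
      rewrite <- IH; simpl; ring. }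
  split; simpl.
  - replace (fst l * fst m - snd l * snd m)
      with (1 * (fst l * fst m) + -1 * (snd l * snd m)) by ring.
    eapply is_series_ext; [|apply is_series_lin; [exact M11|exact M22]].
    intros n; unfold conv; etransitivity; [|apply S1]; simpl; ring.
  - replace (fst l * snd m + snd l * fst m)
      with (1 * (fst l * snd m) + 1 * (snd l * fst m)) by ring.
    eapply is_series_ext; [|apply is_series_lin; [exact M12|exact M21]].
    intros n; unfold conv; etransitivity; [|apply S2]; simpl; ring.
Qed.

Lemma csum_is_series (u : nat -> C) (l : C) :
  csum u l <-> @is_series C_AbsRing C_NormedModule u l.
Proof.
  assert (F : forall N, fst (sum_n (G := C_NormedModule) u N) = sum_n (fun n => fst (u n)) N).
  { induction N as [|N IH]; [now rewrite !sum_O|]; rewrite !sum_Sn, <- IH; reflexivity. }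
  assert (G : forall N, snd (sum_n (G := C_NormedModule) u N) = sum_n (fun n => snd (u n)) N).
  { induction N as [|N IH]; [now rewrite !sum_O|]; rewrite !sum_Sn, <- IH; reflexivity. }
  unfold csum, is_series; split.
  - intros [H1 H2].
    apply filterlim_locally; intros eps.
    pose proof (proj1 (filterlim_locally _ _) H1 eps) as L1.
    pose proof (proj1 (filterlim_locally _ _) H2 eps) as L2.
    eapply filter_imp; [|apply (filter_and _ _ L1 L2)].
    intros N [B1 B2]; split; [rewrite F|rewrite G]; assumption.
  - intros H; pose proof (proj1 (filterlim_locally _ _) H) as L.
    split; apply filterlim_locally; intros eps; (eapply filter_imp; [|apply (L eps)]);
      intros N [B1 B2]; [rewrite F in B1|rewrite G in B2]; assumption.
Qed.

Definition pser (a : nat -> C) (z : C) : C :=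
  (Series (fun n => fst (a n * z ^ n)%C), Series (fun n => snd (a n * z ^ n)%C)).

(* By Hadamard's formula: the radius of convergence is at least 1. *)
Definition radius1 (a : nat -> C) : Prop :=
  forall r, 0 < r < 1 -> exists M, forall n, Cmod (a n) * r ^ n <= M.

Lemma radius1_ex_series (a : nat -> C) (r : R) : radius1 a -> 0 <= r < 1 ->
  ex_series (fun n => Cmod (a n) * r ^ n).
Proof.
  (* Boundedness at a radius s strictly between r and 1 gives comparison with the geometric series
     of ratio r / s. *)
  intros Ha Hr; destruct (Ha ((1 + r) / 2) ltac:(lra)) as [M HM].
  set (s := (1 + r) / 2) in *; assert (Hs : 0 < s < 1) by (unfold s; lra).
  assert (Hq : 0 <= r / s < 1).
  { split; [apply Rmult_le_pos; [lra|apply Rlt_le, Rinv_0_lt_compat; lra]|].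
    apply Rmult_lt_reg_r with s; [lra|].
    replace (r / s * s) with r by (field; lra); unfold s; lra. }
  apply ex_series_Rabs_le with (fun n => M * (r / s) ^ n).
  - intros n; rewrite Rabs_right.
    2:{ apply Rle_ge, Rmult_le_pos; [apply Cmod_ge_0|apply pow_le; lra]. }
    replace (Cmod (a n) * r ^ n) with ((Cmod (a n) * s ^ n) * (r / s) ^ n).
    + apply Rmult_le_compat_r; [apply pow_le; lra|apply HM].
    + rewrite Rmult_assoc, <- Rpow_mult_distr; do 2 f_equal; field; lra.
  - apply (ex_series_scal_l M (fun n => (r / s) ^ n)), ex_series_geom.
    rewrite Rabs_right; lra.
Qed.

Lemma pser_csum (a : nat -> C) (z : C) : radius1 a -> inD z ->
  csum (fun n => a n * z ^ n)%C (pser a z).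
Proof.
  intros Ha Hz; apply csum_abs with (fun n => Cmod (a n) * Cmod z ^ n).
  - intros n; rewrite Cmod_mult, Cmod_pow; lra.
  - apply radius1_ex_series; [exact Ha|]; split; [apply Cmod_ge_0|exact Hz].
Qed.

Lemma pser_unique (a : nat -> C) (z l : C) :
  csum (fun n => a n * z ^ n)%C l -> pser a z = l.
Proof.
  intros [H1 H2]; unfold pser; rewrite (is_series_unique _ _ H1), (is_series_unique _ _ H2).
  now destruct l.
Qed.

Lemma pser_ext (a b : nat -> C) (z : C) : (forall n, a n = b n) -> pser a z = pser b z.
Proof. intros E; unfold pser; f_equal; apply Series_ext; intros n; now rewrite E. Qed.

Lemma pser_norm_le (a : nat -> C) (z : C) (r : R) : radius1 a -> 0 <= r < 1 -> Cmod z <= r ->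
  Cmod (pser a z) <= Series (fun n => Cmod (a n) * r ^ n).
Proof.
  intros Ha Hr Hz; eapply csum_norm_le; [apply pser_csum; [exact Ha|unfold inD; lra]| |].
  - intros n; simpl; rewrite Cmod_mult, Cmod_pow.
    apply Rmult_le_compat_l; [apply Cmod_ge_0|apply pow_incr; split; [apply Cmod_ge_0|exact Hz]].
  - now apply radius1_ex_series.
Qed.

Lemma radius1_ext (a b : nat -> C) : (forall n, a n = b n) -> radius1 a -> radius1 b.
Proof. intros E Ha r Hr; destruct (Ha r Hr) as [M HM]; exists M; intros n; now rewrite <- E. Qed.

Lemma radius1_shift (a : nat -> C) : radius1 a -> radius1 (fun n => a (S n)).
Proof.
  intros Ha r Hr; destruct (Ha r Hr) as [M HM]; exists (M / r); intros n.
  specialize (HM (S n)); simpl in HM.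
  apply Rmult_le_reg_r with r; [lra|].
  replace (M / r * r) with M by (field; lra); lra.
Qed.

Lemma radius1_plus (a b : nat -> C) :
  radius1 a -> radius1 b -> radius1 (fun n => a n + b n)%C.
Proof.
  intros Ha Hb r Hr; destruct (Ha r Hr) as [M HM], (Hb r Hr) as [N HN]; exists (M + N); intros n.
  specialize (HM n); specialize (HN n).
  assert (0 <= r ^ n) by (apply pow_le; lra).
  pose proof (Cmod_triangle (a n) (b n)); nra.
Qed.

Lemma radius1_scal (c : C) (a : nat -> C) : radius1 a -> radius1 (fun n => c * a n)%C.
Proof.
  intros Ha r Hr; destruct (Ha r Hr) as [M HM]; exists (Cmod c * M); intros n.
  rewrite Cmod_mult, Rmult_assoc; apply Rmult_le_compat_l; [apply Cmod_ge_0|apply HM].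
Qed.

(** Bernoulli's inequality [poly] gives n h <= (s / r)^n for h = s / r - 1, so n r^n <= s^n / h, and
    the factor n is paid for by the larger radius s. *)
Lemma radius1_nat (a : nat -> C) : radius1 a -> radius1 (fun n => RtoC (INR n) * a n)%C.
Proof.
  intros Ha r Hr; destruct (Ha ((1 + r) / 2) ltac:(lra)) as [M HM].
  set (s := (1 + r) / 2) in *; assert (Hs : r < s < 1) by (unfold s; lra).
  set (h := s / r - 1).
  assert (Hh : 0 < h).
  { unfold h; apply Rmult_lt_reg_r with r; [lra|].
    replace ((s / r - 1) * r) with (s - r) by (field; lra); lra. }
  exists (M / h); intros n.
  rewrite Cmod_mult, Cmod_R, Rabs_right by (apply Rle_ge, pos_INR).
  pose proof (poly n h Hh) as P; replace (1 + h) with (s / r) in P by (unfold h; ring).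
  assert (Hrn : 0 < r ^ n) by (apply pow_lt; lra).
  apply Rmult_le_reg_r with h; [exact Hh|].
  replace (M / h * h) with M by (field; lra).
  apply Rle_trans with (Cmod (a n) * s ^ n); [|apply HM].
  replace (s ^ n) with ((s / r) ^ n * r ^ n).
  2:{ rewrite <- Rpow_mult_distr; f_equal; field; lra. }
  pose proof (Cmod_ge_0 (a n)).
  assert (INR n * h <= (s / r) ^ n) by lra.
  replace (INR n * Cmod (a n) * r ^ n * h) with (Cmod (a n) * (INR n * h * r ^ n)) by ring.
  apply Rmult_le_compat_l; [assumption|]; apply Rmult_le_compat_r; lra.
Qed.

Lemma radius1_bounded (a : nat -> C) (M : R) : (forall n, Cmod (a n) <= M) -> radius1 a.
Proof.
  intros H r Hr; exists M; intros n.
  assert (0 < r ^ n <= 1).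
  { split; [apply pow_lt; lra|]; rewrite <- (pow1 n); apply pow_incr; lra. }
  pose proof (H n); pose proof (Cmod_ge_0 (a n)); nra.
Qed.

Lemma pser_shift (a : nat -> C) (z : C) : radius1 a -> inD z ->
  pser a z = (a 0%nat + z * pser (fun n => a (S n)) z)%C.
Proof.
  intros Ha Hz; apply pser_unique, csum_incr.
  replace (a 0%nat + z * pser (fun n => a (S n)) z - a 0%nat * z ^ 0)%C
    with (z * pser (fun n => a (S n)) z)%C by (simpl; ring).
  eapply csum_ext; [|apply csum_scal, pser_csum; [apply radius1_shift, Ha|exact Hz]].
  intros n; simpl; ring.
Qed.

Lemma pser_plus (a b : nat -> C) (z : C) : radius1 a -> radius1 b -> inD z ->
  pser (fun n => a n + b n)%C z = (pser a z + pser b z)%C.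
Proof.
  intros Ha Hb Hz; apply pser_unique.
  eapply csum_ext; [|apply csum_plus; apply pser_csum; eassumption].
  intros n; simpl; ring.
Qed.

Lemma pser_scal (c : C) (a : nat -> C) (z : C) : radius1 a -> inD z ->
  pser (fun n => c * a n)%C z = (c * pser a z)%C.
Proof.
  intros Ha Hz; apply pser_unique.
  eapply csum_ext; [|apply csum_scal, pser_csum; eassumption].
  intros n; simpl; ring.
Qed.

Lemma pser_mult (a b : nat -> C) (z : C) : radius1 a -> radius1 b -> inD z ->
  pser (conv a b) z = (pser a z * pser b z)%C.
Proof.
  intros Ha Hb Hz; apply pser_unique.
  assert (Habs : forall c : nat -> C, radius1 c -> ex_series (fun n => Cmod (c n * z ^ n)%C)).
  { intros c Hc; apply ex_series_ext with (fun n => Cmod (c n) * Cmod z ^ n).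
    - intros n; now rewrite Cmod_mult, Cmod_pow.
    - apply radius1_ex_series; [exact Hc|]; split; [apply Cmod_ge_0|exact Hz]. }
  eapply csum_ext; [|apply csum_mult;
    [apply (pser_csum a)|apply (pser_csum b)|apply (Habs a)|apply (Habs b)]; assumption].
  intros n; unfold conv.
  assert (E : forall N, (N <= n)%nat ->
    sum_n (G := C_NormedModule) (fun k => a k * z ^ k * (b (n - k)%nat * z ^ (n - k)))%C N =
    (sum_n (G := C_NormedModule) (fun k => a k * b (n - k)%nat)%C N * z ^ n)%C); [|now apply E].
  induction N as [|N IH]; intros HN.
  - rewrite !sum_O, Nat.sub_0_r; simpl; ring.
  - rewrite !sum_Sn, IH by lia.
    replace (z ^ n)%C with (z ^ S N * z ^ (n - S N))%C
      by (rewrite <- Cpow_add_r; f_equal; lia).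
    generalize (sum_n (G := C_NormedModule) (fun k => a k * b (n - k)%nat)%C N).
    intros x; unfold plus; simpl; ring.
Qed.

(* Coefficients of the divided difference (pser a z - pser a z0) / (z - z0),
   by synthetic division. *)
Definition dquot (a : nat -> C) (z0 : C) (k : nat) : C := pser (fun n => a (S k + n)%nat) z0.

Lemma radius1_shift_n (a : nat -> C) (k : nat) :
  radius1 a -> radius1 (fun n => a (k + n)%nat).
Proof.
  intros Ha; induction k as [|k IH]; [exact Ha|].
  apply radius1_shift in IH; eapply radius1_ext; [|exact IH].
  intros n; simpl; f_equal; lia.
Qed.

Lemma dquot_rec (a : nat -> C) (z0 : C) (k : nat) : radius1 a -> inD z0 ->
  dquot a z0 k = (a (S k) + z0 * dquot a z0 (S k))%C.
Proof.
  intros Ha Hz; unfold dquot.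
  rewrite (pser_shift (fun n => a (S k + n)%nat)) by (auto using radius1_shift_n).
  rewrite Nat.add_0_r; do 2 f_equal; apply pser_ext; intros n; f_equal; lia.
Qed.

(** For s above both r and |z0|, |a_m| <= M / s^m bounds the k-th coefficient by M / s^(k+1) times
    the geometric series in |z0| / s. *)
Lemma radius1_dquot (a : nat -> C) (z0 : C) : radius1 a -> inD z0 -> radius1 (dquot a z0).
Proof.
  intros Ha Hz r Hr; unfold inD in Hz; pose proof (Cmod_ge_0 z0) as Hz0.
  set (s := (1 + Rmax r (Cmod z0)) / 2).
  assert (Hs : r < s < 1 /\ Cmod z0 < s).
  { unfold s; pose proof (Rmax_l r (Cmod z0)); pose proof (Rmax_r r (Cmod z0)).
    assert (Rmax r (Cmod z0) < 1) by (apply Rmax_lub_lt; lra); lra. }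
  destruct (Ha s ltac:(lra)) as [M HM].
  assert (Hq : 0 <= Cmod z0 / s < 1).
  { split; [apply Rmult_le_pos; [lra|apply Rlt_le, Rinv_0_lt_compat; lra]|].
    apply Rmult_lt_reg_r with s; [lra|].
    replace (Cmod z0 / s * s) with (Cmod z0) by (field; lra); lra. }
  set (q := Cmod z0 / s) in *.
  assert (Eq : ex_series (fun n => q ^ n)) by (apply ex_series_geom; rewrite Rabs_right; lra).
  exists (M / s * Series (fun n => q ^ n)); intros k.
  assert (Hk : 0 < s ^ k) by (apply pow_lt; lra).
  assert (HB : Cmod (dquot a z0 k) <= M / s / s ^ k * Series (fun n => q ^ n)).
  { rewrite <- Series_scal_l; eapply csum_norm_le.
    - apply pser_csum; [apply radius1_shift_n, Ha|exact Hz].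
    - intros n; cbv beta; rewrite Cmod_mult, Cmod_pow.
      specialize (HM (S k + n)%nat).
      assert (Hn : 0 < s ^ n) by (apply pow_lt; lra).
      replace (Cmod z0 ^ n) with (q ^ n * s ^ n).
      2:{ unfold q; rewrite <- Rpow_mult_distr; f_equal; field; lra. }
      replace (Cmod (a (S k + n)%nat) * (q ^ n * s ^ n))
        with ((Cmod (a (S k + n)%nat) * s ^ n) * q ^ n) by ring.
      apply Rmult_le_compat_r; [apply pow_le; lra|].
      rewrite pow_add in HM; simpl (s ^ S k) in HM.
      apply Rmult_le_reg_r with (s * s ^ k); [apply Rmult_lt_0_compat; lra|].
      replace (M / s / s ^ k * (s * s ^ k)) with M by (field; lra); lra.
    - now apply (ex_series_scal_l _ (fun n => q ^ n)). }
  assert (H0 : 0 <= M / s / s ^ k * Series (fun n => q ^ n)).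
  { eapply Rle_trans; [apply Cmod_ge_0|exact HB]. }
  apply Rle_trans with (M / s / s ^ k * Series (fun n => q ^ n) * s ^ k).
  - apply Rmult_le_compat; [apply Cmod_ge_0|apply pow_le; lra|exact HB|apply pow_incr; lra].
  - right; field; lra.
Qed.

(** The recursion a_(k+1) = b_k - z0 b_(k+1) of [dquot_rec], summed against the powers of z. *)
Lemma pser_dquot (a : nat -> C) (z0 z : C) : radius1 a -> inD z0 -> inD z ->
  pser a z = (pser a z0 + (z - z0) * pser (dquot a z0) z)%C.
Proof.
  intros Ha Hz0 Hz; pose proof (radius1_dquot a z0 Ha Hz0) as Hb.
  pose proof (radius1_shift _ Hb) as Hb'.
  assert (E : pser (fun n => a (S n)) z =
    (pser (dquot a z0) z - z0 * pser (fun n => dquot a z0 (S n)) z)%C).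
  { replace (pser (dquot a z0) z - z0 * pser (fun n => dquot a z0 (S n)) z)%C
      with (pser (dquot a z0) z + (- z0) * pser (fun n => dquot a z0 (S n)) z)%C by ring.
    rewrite <- pser_scal, <- pser_plus by (auto using radius1_scal).
    apply pser_ext; intros n; rewrite (dquot_rec a z0 n Ha Hz0); ring. }
  assert (F : pser (fun n => a (S n)) z0 = dquot a z0 0)
    by reflexivity.
  pose proof (pser_shift _ z Hb Hz) as G.
  rewrite (pser_shift a z Ha Hz), (pser_shift a z0 Ha Hz0), E, F.
  rewrite G at 1.
  set (B := pser (fun n => dquot a z0 (S n)) z) in *.
  rewrite G; ring.
Qed.

(** The divided difference is again a power series of the same kind, so the induction on the order
    runs over all coefficient sequences at once. *)
Lemma hol_pser (a : nat -> C) : radius1 a -> hol (pser a).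
Proof.
  intros Ha z Hz n; revert a Ha; induction n as [|n IH]; intros a Ha.
  - unfold inD in Hz; pose proof (Cmod_ge_0 z).
    set (r := (1 + Cmod z) / 2); exists (Series (fun n => Cmod (a n) * r ^ n)).
    eapply near_imp; [|apply (near_ball z (r - Cmod z)); unfold r; lra].
    intros y Hy; simpl in Hy; apply pser_norm_le; [exact Ha|unfold r; lra|].
    pose proof (Cmod_le_plus_minus y z); lra.
  - exists (pser (dquot a z)); split; [|apply IH, radius1_dquot; assumption].
    eapply near_imp; [|apply near_inD, Hz]; intros y Hy; now apply pser_dquot.
Qed.

Definition dcoef (a : nat -> C) (n : nat) : C := (RtoC (INR (S n)) * a (S n))%C.

Lemma radius1_dcoef (a : nat -> C) : radius1 a -> radius1 (dcoef a).
Proof. intros Ha; apply (radius1_shift (fun n => RtoC (INR n) * a n)%C), radius1_nat, Ha. Qed.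

(* With b = dquot a z0, (k+1) a_{k+1} = b_k + k b_k - z0 (k+1) b_{k+1}, and the last
   two terms telescope. *)
Lemma pser_dquot_diag (a : nat -> C) (z0 : C) : radius1 a -> inD z0 ->
  pser (dquot a z0) z0 = pser (dcoef a) z0.
Proof.
  intros Ha Hz0; pose proof (radius1_dquot a z0 Ha Hz0) as Hb.
  set (b := dquot a z0) in *; set (c := fun n => (RtoC (INR n) * b n)%C).
  assert (Hc : radius1 c) by now apply radius1_nat.
  pose proof (radius1_shift _ Hc) as Hc'.
  transitivity (pser b z0 + (pser c z0 + (- z0) * pser (fun n => c (S n)) z0))%C.
  - rewrite (pser_shift c z0 Hc Hz0); unfold c at 1; simpl (INR 0); ring.
  - rewrite <- pser_scal, <- !pser_plus by (auto using radius1_scal, radius1_plus).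
    apply pser_ext; intros n; unfold dcoef, c, b.
    rewrite (dquot_rec a z0 n Ha Hz0), S_INR, RtoC_plus; ring.
Qed.

Lemma is_derive_near (f : C -> C) (z d : C) :
  @is_derive C_AbsRing C_NormedModule f z d <->
  forall eps, 0 < eps -> near z (fun y => Cmod (f y - f z - (y - z) * d) <= eps * Cmod (y - z)).
Proof.
  split.
  - intros [_ H] eps Heps.
    destruct (H z (fun P HP => HP) (mkposreal eps Heps)) as [e He].
    exists e; split; [apply cond_pos|]; intros y Hy; exact (He y Hy).
  - intros H; split; [apply is_linear_scal_l|].
    (* The differential is required at every limit point [x] of the neighbourhood filter of [z];
       uniqueness of limits leaves only [z]. *)
    intros x Hx.
    rewrite <- (is_filter_lim_locally_unique (V := AbsRing_NormedModule C_AbsRing) z x Hx).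
    clear x Hx.
    intros eps; destruct (H eps (cond_pos eps)) as [d0 [Hd0 HH]].
    exists (mkposreal d0 Hd0); intros y Hy; exact (HH y Hy).
Qed.

Lemma quotient_is_derive (f g : C -> C) (z : C) :
  near z (fun y => f y = (f z + (y - z) * g y)%C) -> cont g z ->
  @is_derive C_AbsRing C_NormedModule f z (g z).
Proof.
  intros H Hc; apply is_derive_near; intros eps Heps.
  eapply near_imp; [|apply (near_and _ _ _ H (Hc eps Heps))].
  intros y [E1 E2]; simpl in E1, E2; rewrite E1.
  replace (f z + (y - z) * g y - f z - (y - z) * g z)%C
    with ((y - z) * (g y - g z))%C by ring.
  rewrite Cmod_mult, Rmult_comm; apply Rmult_le_compat_r; [apply Cmod_ge_0|lra].
Qed.

Lemma derive_cont (f : C -> C) (z d : C) :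
  @is_derive C_AbsRing C_NormedModule f z d -> cont f z.
Proof.
  intros H eps Heps; pose proof (proj1 (is_derive_near f z d) H 1 Rlt_0_1) as [e [He HH]].
  pose proof (Cmod_ge_0 d).
  assert (Hp : 0 < eps / (2 + Cmod d)) by (apply Rdiv_lt_0_compat; lra).
  exists (Rmin e (eps / (2 + Cmod d))); split; [now apply Rmin_pos|].
  intros y Hy; specialize (HH y (Rlt_le_trans _ _ _ Hy (Rmin_l _ _))).
  pose proof (Rlt_le_trans _ _ _ Hy (Rmin_r _ _)) as Hy2.
  apply Rmult_lt_compat_r with (r := 2 + Cmod d) in Hy2; [|lra].
  replace (eps / (2 + Cmod d) * (2 + Cmod d)) with eps in Hy2 by (field; lra).
  pose proof (Cmod_le_plus_minus (f y - f z) ((y - z) * d)) as T.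
  rewrite Cmod_mult in T; pose proof (Cmod_ge_0 (y - z)); nra.
Qed.

Lemma derive_unique (f : C -> C) (z d e : C) :
  @is_derive C_AbsRing C_NormedModule f z d ->
  @is_derive C_AbsRing C_NormedModule f z e -> d = e.
Proof. intros H1 H2; now rewrite <- (is_C_derive_unique _ _ _ H1), <- (is_C_derive_unique _ _ _ H2). Qed.

Lemma is_derive_pser (a : nat -> C) (z : C) : radius1 a -> inD z ->
  @is_derive C_AbsRing C_NormedModule (pser a) z (pser (dcoef a) z).
Proof.
  intros Ha Hz; rewrite <- pser_dquot_diag by assumption.
  apply quotient_is_derive.
  - eapply near_imp; [|apply near_inD, Hz]; intros y Hy; now apply pser_dquot.
  - apply hol_cont; [apply hol_pser, radius1_dquot|]; assumption.
Qed.

Lemma coeffs_csum (a : nat -> C) (z l : C) :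
  @is_pseries C_AbsRing C_NormedModule a z l <-> csum (fun n => a n * z ^ n)%C l.
Proof.
  rewrite csum_is_series; unfold is_pseries; split; apply is_series_ext; intros n.
  - exact (Cmult_comm (z ^ n)%C (a n)).
  - exact (Cmult_comm (a n) (z ^ n)%C).
Qed.

(** Convergence at the real point r makes the terms a_n r^n bounded; sqrt 2 passes from their two
    components to the modulus. *)
Lemma coeffs_radius1 (f : C -> C) (a : nat -> C) : coeffs_of f a -> radius1 a.
Proof.
  intros H r Hr.
  assert (Hz : inD (RtoC r)) by (unfold inD; rewrite Cmod_R, Rabs_right; lra).
  specialize (H _ Hz); apply coeffs_csum in H; destruct H as [H1 H2].
  assert (Hb : forall u l, is_series u l -> exists M : R, forall n : nat, Rabs (u n) <= M).
  { intros u l Hu.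
    destruct (filterlim_bounded (K := R_AbsRing) (V := R_NormedModule) u) as [M HM];
      [|now exists M].
    exists 0; apply ex_series_lim_0; now exists l. }
  destruct (Hb _ _ H1) as [M1 HM1], (Hb _ _ H2) as [M2 HM2].
  exists (sqrt 2 * Rmax M1 M2); intros n.
  replace (r ^ n) with (Cmod (RtoC r ^ n)%C)
    by (rewrite Cmod_pow, Cmod_R, Rabs_right; lra).
  rewrite <- Cmod_mult; eapply Rle_trans; [apply Cmod_2Rmax|].
  apply Rmult_le_compat_l; [apply sqrt_pos|].
  apply Rmax_lub; [eapply Rle_trans; [apply HM1|apply Rmax_l]
                  |eapply Rle_trans; [apply HM2|apply Rmax_r]].
Qed.

Lemma coeffs_pser (f : C -> C) (a : nat -> C) (z : C) : coeffs_of f a -> inD z -> f z = pser a z.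
Proof. intros H Hz; symmetry; apply pser_unique, coeffs_csum, H, Hz. Qed.

(** * The function xi and subordination *)

Definition sin_coef (n : nat) : R :=
  if Nat.odd n then (-1) ^ Nat.div2 n / INR (fact n) else 0.

Lemma sin_coef_even (k : nat) : sin_coef (2 * k) = 0.
Proof. unfold sin_coef; now rewrite Nat.odd_mul. Qed.

Lemma sin_coef_odd (k : nat) : sin_coef (2 * k + 1) = (-1) ^ k / INR (fact (2 * k + 1)).
Proof.
  unfold sin_coef; rewrite Nat.odd_add, Nat.odd_mul.
  replace (2 * k + 1)%nat with (S (2 * k)) by lia; now rewrite Nat.div2_succ_double.
Qed.

Lemma parity_cases (n : nat) : exists k, n = (2 * k)%nat \/ n = (2 * k + 1)%nat.
Proof.
  destruct (Nat.Even_or_Odd n) as [[k Hk]|[k Hk]]; exists k; auto.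
Qed.

Lemma sin_coef_bound (n : nat) : Rabs (sin_coef n) <= / INR (fact n).
Proof.
  pose proof (INR_fact_lt_0 n) as Hf.
  unfold sin_coef; destruct (Nat.odd n).
  - unfold Rdiv; rewrite Rabs_mult, pow_1_abs, (Rabs_right (/ _)); [lra|].
    left; now apply Rinv_0_lt_compat.
  - rewrite Rabs_R0; left; now apply Rinv_0_lt_compat.
Qed.

Lemma inv_fact_le_1 (n : nat) : / INR (fact n) <= 1.
Proof.
  rewrite <- Rinv_1; apply Rinv_le_contravar; [lra|].
  apply (le_INR 1), lt_O_fact.
Qed.

Definition sinC (n : nat) : C := RtoC (sin_coef n).

Lemma radius1_sinC : radius1 sinC.
Proof.
  apply radius1_bounded with 1; intros n; unfold sinC; rewrite Cmod_R.
  eapply Rle_trans; [apply sin_coef_bound|apply inv_fact_le_1].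
Qed.

(** Relates the series of [Csin], indexed by odd powers only, to a full power series: partial sum N
    of the former is partial sum 2N + 1 of the latter. *)
Lemma is_series_odd (u : nat -> R) (l : R) : (forall k, u (2 * k)%nat = 0) ->
  is_series u l -> is_series (fun k => u (2 * k + 1)%nat) l.
Proof.
  intros H0 Hu.
  assert (E : forall N, sum_n (fun k => u (2 * k + 1)%nat) N = sum_n u (2 * N + 1)).
  { induction N as [|N IH].
    - rewrite sum_O; simpl (2 * 0 + 1)%nat; rewrite sum_Sn, sum_O.
      rewrite (H0 0%nat : u 0%nat = 0); symmetry; apply (Rplus_0_l (u 1%nat)).
    - rewrite sum_Sn, IH.
      replace (2 * S N + 1)%nat with (S (S (2 * N + 1))) by lia.
      rewrite !sum_Sn; replace (S (2 * N + 1)) with (2 * S N)%nat by lia.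
      rewrite H0; unfold plus; simpl; ring. }
  unfold is_series; eapply filterlim_ext; [intros N; symmetry; apply E|].
  apply (filterlim_comp _ _ _ (fun N => 2 * N + 1)%nat (sum_n u) _ eventually); [|exact Hu].
  intros P [N HN]; exists N; intros n Hn; apply HN; lia.
Qed.

Lemma Csin_pser (z : C) : inD z -> Csin z = pser sinC z.
Proof.
  intros Hz; destruct (pser_csum sinC z radius1_sinC Hz) as [H1 H2].
  apply is_series_odd in H1;
    [|intros k; unfold sinC; rewrite sin_coef_even; simpl; ring].
  apply is_series_odd in H2;
    [|intros k; unfold sinC; rewrite sin_coef_even; simpl; ring].
  unfold Csin; apply injective_projections; simpl fst; simpl snd;
    apply is_series_unique; (eapply is_series_ext; [|eassumption]);
    intros k; unfold Csin_term, sinC, Re, Im; now rewrite sin_coef_odd.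
Qed.

(** Obtained as the series of e minus its own shift, that is e - (e - 1). *)
Lemma is_series_fact_telescope :
  is_series (fun n => / INR (fact n) - / INR (fact (S n))) 1.
Proof.
  assert (He : is_series (fun n => / INR (fact n)) (exp 1)).
  { eapply is_series_ext; [|exact (proj1 (is_pseries_R _ _ _) (is_exp_Reals 1))].
    intros n; cbv beta; rewrite pow1; apply Rmult_1_r. }
  pose proof (proj1 (is_series_incr_iff _ _) He) as He'.
  pose proof (is_series_lin _ _ 1 (-1) _ _ He He') as H.
  assert (E : 1 * exp 1 + -1 * (exp 1 - / INR (fact 0)) = 1) by (simpl; field).
  rewrite <- E.
  eapply is_series_ext; [|exact H]; intros n; simpl; ring.
Qed.

(* (1-u) cos u + sin u = 1 + u * sum_n theta_n u^n with
   |theta_n| <= n/(n+1)! = 1/n! - 1/(n+1)!, and these bounds sum up to 1. *)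
Lemma xi_derivative_numerator_neq_0 (u : C) : inD u ->
  (pser (dcoef sinC) u * (1 - u) + pser sinC u)%C <> RtoC 0.
Proof.
  intros Hu; pose proof radius1_sinC as Hs.
  pose proof (radius1_dcoef _ Hs) as Hd.
  pose proof (radius1_shift _ Hs) as Hs'; pose proof (radius1_shift _ Hd) as Hd'.
  set (theta := fun n => (dcoef sinC (S n) + (sinC (S n) + (- RtoC 1) * dcoef sinC n))%C).
  pose proof (radius1_scal (- RtoC 1) _ Hd) as Hds.
  pose proof (radius1_plus _ _ Hs' Hds) as Hsd.
  assert (Ht : radius1 theta) by exact (radius1_plus _ _ Hd' Hsd).
  assert (Hb : forall n, Cmod (theta n) <= / INR (fact n) - / INR (fact (S n))).
  { intros n.
    assert (E : theta n = RtoC (INR (S (S n)) * sin_coef (S (S n)) - INR n * sin_coef (S n))).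
    { unfold theta, dcoef, sinC.
      rewrite RtoC_minus, !RtoC_mult, (S_INR n), RtoC_plus; ring. }
    rewrite E, Cmod_R; clear E.
    pose proof (INR_fact_lt_0 n) as F0; pose proof (INR_fact_lt_0 (S n)) as F1.
    assert (E1 : / INR (fact n) - / INR (fact (S n)) = INR n * / INR (fact (S n))).
    { rewrite fact_simpl, mult_INR, S_INR; pose proof (pos_INR n); field; lra. }
    assert (E2 : INR (S (S n)) * / INR (fact (S (S n))) = / INR (fact (S n))).
    { rewrite (fact_simpl (S n)), mult_INR; field; split; [lra|apply not_0_INR; lia]. }
    rewrite E1.
    pose proof (sin_coef_bound (S n)) as B1; pose proof (sin_coef_bound (S (S n))) as B2.
    pose proof (pos_INR n) as Hn; pose proof (pos_INR (S (S n))) as Hn2.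
    assert (Hi : 0 < / INR (fact (S n))) by now apply Rinv_0_lt_compat.
    (* By parity only one of the two sine coefficients in [theta n] survives. For odd n it
       contributes 1/(n+1)!, which is within the bound because n >= 1. *)
    destruct (parity_cases n) as [k [Hk|Hk]].
    - replace (S (S n)) with (2 * S k)%nat by lia; rewrite sin_coef_even.
      rewrite Rmult_0_r, Rminus_0_l, Rabs_Ropp, Rabs_mult, Rabs_right by lra.
      now apply Rmult_le_compat_l.
    - replace (sin_coef (S n)) with 0
        by (replace (S n) with (2 * S k)%nat by lia; now rewrite sin_coef_even).
      rewrite Rmult_0_r, Rminus_0_r, Rabs_mult, Rabs_right by lra.
      apply Rle_trans with (/ INR (fact (S n))).
      + rewrite <- E2; now apply Rmult_le_compat_l.
      + assert (1 <= INR n) by (apply (le_INR 1); lia).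
        rewrite <- (Rmult_1_l (/ _)) at 1; apply Rmult_le_compat_r; lra. }
  assert (Hle : Cmod (pser theta u) <= 1).
  { rewrite <- (is_series_unique _ _ is_series_fact_telescope).
    eapply csum_norm_le; [apply pser_csum; [exact Ht|exact Hu]| |].
    - intros n; cbv beta; rewrite Cmod_mult, Cmod_pow.
      eapply Rle_trans; [|apply Hb].
      rewrite <- (Rmult_1_r (Cmod (theta n))) at 2.
      apply Rmult_le_compat_l; [apply Cmod_ge_0|].
      rewrite <- (pow1 n); apply pow_incr; split; [apply Cmod_ge_0|unfold inD in Hu; lra].
    - eexists; apply is_series_fact_telescope. }
  assert (E : (pser (dcoef sinC) u * (1 - u) + pser sinC u = 1 + u * pser theta u)%C).
  { unfold theta.
    rewrite (pser_plus _ _ u Hd' Hsd), (pser_plus _ _ u Hs' Hds), (pser_scal _ _ u Hd) by exact Hu.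
    rewrite (pser_shift sinC u Hs Hu).
    rewrite (pser_shift (dcoef sinC) u Hd Hu).
    replace (dcoef sinC 0) with (RtoC 1)
      by (unfold dcoef, sinC, sin_coef; simpl; rewrite <- RtoC_mult; f_equal; field).
    replace (sinC 0) with (RtoC 0) by reflexivity.
    set (x := pser (fun n => dcoef sinC (S n)) u); set (y := pser (fun n => sinC (S n)) u).
    ring. }
  rewrite E; intros E0.
  assert (H1 : (u * pser theta u = - (1))%C).
  { replace (u * pser theta u)%C with ((1 + u * pser theta u) - 1)%C by ring; rewrite E0; ring. }
  apply (f_equal Cmod) in H1; rewrite Cmod_opp, Cmod_1, Cmod_mult in H1.
  unfold inD in Hu; pose proof (Cmod_ge_0 u); pose proof (Cmod_ge_0 (pser theta u)); nra.
Qed.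

Lemma inD_neq_1 (z : C) : inD z -> (1 - z)%C <> RtoC 0.
Proof.
  unfold inD; intros Hz E.
  assert (Hz1 : z = RtoC 1) by (replace z with (1 - (1 - z))%C by ring; rewrite E; ring).
  rewrite Hz1, Cmod_1 in Hz; lra.
Qed.

Lemma xi_pser (z : C) : inD z -> xi z = (1 + pser sinC z / (1 - z))%C.
Proof. intros Hz; unfold xi; now rewrite Csin_pser. Qed.

(** Quotient rule for the divided difference of sin u / (1 - u); on the diagonal it is xi'(u) = ((1
    - u) cos u + sin u) / (1 - u)^2. *)
Definition xi_dquot (u0 u : C) : C :=
  ((pser (dquot sinC u0) u * (1 - u0) + pser sinC u0) / ((1 - u) * (1 - u0)))%C.

Lemma xi_dquot_eq (u0 u : C) : inD u0 -> inD u ->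
  (xi u - xi u0 = (u - u0) * xi_dquot u0 u)%C.
Proof.
  intros H0 Hu; rewrite !xi_pser by assumption; unfold xi_dquot.
  rewrite (pser_dquot sinC u0 u radius1_sinC H0 Hu).
  field; auto using inD_neq_1.
Qed.

Lemma hol_id : hol (fun z => z).
Proof. intros z _ n; apply taylor_id. Qed.

Lemma hol_xi_dquot (u0 : C) : inD u0 -> hol (xi_dquot u0).
Proof.
  intros H0; apply hol_div.
  - apply hol_plus; [apply hol_mult|]; auto using hol_const.
    apply hol_pser, radius1_dquot; auto using radius1_sinC.
  - apply hol_mult; [apply hol_minus|]; auto using hol_const, hol_id.
  - intros z Hz; apply Cmult_neq_0; now apply inD_neq_1.
Qed.

Lemma xi_dquot_diag (u : C) : inD u -> xi_dquot u u <> RtoC 0.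
Proof.
  intros Hu; unfold xi_dquot; rewrite pser_dquot_diag by (auto using radius1_sinC).
  unfold Cdiv; apply Cmult_neq_0; [now apply xi_derivative_numerator_neq_0|].
  pose proof (inD_neq_1 u Hu) as H1.
  intros E.
  assert (E' : (((1 - u) * (1 - u)) * / ((1 - u) * (1 - u)) = 1)%C)
    by (field; exact H1).
  rewrite E, Cmult_0_r in E'; apply RtoC_inj in E'; lra.
Qed.

(* Since xi' does not vanish, xi (w) = f1 / f0 inherits all Taylor expansions to w. *)
Lemma hol_subordinate (w : C -> C) (a b : nat -> C) :
  radius1 a -> radius1 b -> (forall z, inD z -> cont w z) ->
  (forall z, inD z -> inD (w z)) ->
  (forall z, inD z -> pser b z <> RtoC 0 /\ (pser a z = pser b z * xi (w z))%C) ->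
  hol w.
Proof.
  intros Ha Hb Hc HD HE z Hz n.
  (* The function of [y] is the divided difference at z of the quotient of the two power series,
     that is of xi o w; equating it with that of the composite gives the relation [taylor_inverse]
     asks for. *)
  apply (taylor_inverse n z w
    (fun y => (pser (dquot a z) y * pser b z - pser a z * pser (dquot b z) y)
              / (pser b y * pser b z))%C (xi_dquot (w z))).
  - now apply Hc.
  - intros m; revert z Hz m; change (forall z, inD z -> forall m, taylor m z (fun y =>
      (pser (dquot a z) y * pser b z - pser a z * pser (dquot b z) y)
              / (pser b y * pser b z))%C).
    intros z Hz; apply (hol_div
      (fun y => pser (dquot a z) y * pser b z - pser a z * pser (dquot b z) y)%C
      (fun y => pser b y * pser b z)%C); [| |  |exact Hz].
    + apply hol_minus; apply hol_mult; auto using hol_const, hol_pser, radius1_dquot.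
    + apply hol_mult; auto using hol_const, hol_pser.
    + intros y Hy; apply Cmult_neq_0; now apply HE.
  - intros m; now apply hol_xi_dquot; apply HD.
  - now apply xi_dquot_diag, HD.
  - eapply near_imp; [|apply near_inD, Hz]; intros y Hy.
    rewrite <- xi_dquot_eq by auto.
    destruct (HE z Hz) as [N1 E1], (HE y Hy) as [N2 E2].
    replace (xi (w y)) with (pser a y / pser b y)%C by (rewrite E2; field; exact N2).
    replace (xi (w z)) with (pser a z / pser b z)%C by (rewrite E1; field; exact N1).
    rewrite (pser_dquot a z y Ha Hz Hy) in *.
    replace ((y - z) * ((pser (dquot a z) y * pser b z - pser a z * pser (dquot b z) y) /
        (pser b y * pser b z)))%C
      with ((((y - z) * pser (dquot a z) y) * pser b z - pser a z * ((y - z) * pser (dquot b z) y)) /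
        (pser b y * pser b z))%C by (unfold Cdiv; ring).
    replace ((y - z) * pser (dquot b z) y)%C with (pser b y - pser b z)%C
      by (rewrite (pser_dquot b z y Hb Hz Hy); ring).
    field; split; assumption.
Qed.

(** Coefficients through z^3 with a merely bounded remainder: [w] is not known to be a power series,
    and no later coefficient enters the theorem. *)
Definition jet (g : C -> C) (c0 c1 c2 c3 : C) : Prop :=
  exists e, taylor 0 (RtoC 0) e /\
    near (RtoC 0) (fun z => g z = c0 + z * (c1 + z * (c2 + z * (c3 + z * e z))))%C.

Lemma jet_const (c : C) : jet (fun _ => c) c (RtoC 0) (RtoC 0) (RtoC 0).
Proof.
  exists (fun _ => RtoC 0); split; [apply taylor_const|].
  apply near_true; intros; ring.
Qed.

Lemma jet_plus (f g : C -> C) (c0 c1 c2 c3 d0 d1 d2 d3 : C) :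
  jet f c0 c1 c2 c3 -> jet g d0 d1 d2 d3 ->
  jet (fun z => f z + g z)%C (c0 + d0)%C (c1 + d1)%C (c2 + d2)%C (c3 + d3)%C.
Proof.
  intros [e [He Ee]] [h [Hh Eh]]; exists (fun z => e z + h z)%C; split.
  - now apply taylor_plus.
  - eapply near_imp; [|apply (near_and _ _ _ Ee Eh)].
    intros z [E1 E2]; simpl in E1, E2; rewrite E1, E2; ring.
Qed.

Lemma jet_mult (f g : C -> C) (c0 c1 c2 c3 d0 d1 d2 d3 : C) :
  jet f c0 c1 c2 c3 -> jet g d0 d1 d2 d3 ->
  jet (fun z => f z * g z)%C (c0 * d0)%C (c0 * d1 + c1 * d0)%C
    (c0 * d2 + c1 * d1 + c2 * d0)%C (c0 * d3 + c1 * d2 + c2 * d1 + c3 * d0)%C.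
Proof.
  intros [e [He Ee]] [h [Hh Eh]].
  set (r := fun z => (c1 + z * (c2 + z * (c3 + z * e z)))%C).
  set (r2 := fun z => (c2 + z * (c3 + z * e z))%C).
  set (r3 := fun z => (c3 + z * e z)%C).
  assert (T3 : taylor 0 (RtoC 0) r3)
    by (apply taylor_plus; [|apply taylor_mult]; auto using taylor_const, taylor_id).
  assert (T2 : taylor 0 (RtoC 0) r2)
    by (apply taylor_plus; [|apply taylor_mult]; auto using taylor_const, taylor_id).
  assert (T1 : taylor 0 (RtoC 0) r)
    by (apply taylor_plus; [|apply taylor_mult]; auto using taylor_const, taylor_id).
  (* All of [f] multiplies the remainder [h] of [g], and each d_j multiplies the tail of [f] that
     starts at degree 4 - j. *)
  exists (fun z => (c0 + z * r z) * h z + (d3 * r z + (d2 * r2 z + (d1 * r3 z + d0 * e z))))%C; split.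
  - repeat (apply taylor_plus || apply taylor_mult);
      auto using taylor_const, taylor_id.
  - eapply near_imp; [|apply (near_and _ _ _ Ee Eh)].
    intros z [E1 E2]; simpl in E1, E2; rewrite E1, E2; unfold r, r2, r3; ring.
Qed.

Lemma jet_pser (a : nat -> C) : radius1 a ->
  jet (pser a) (a 0%nat) (a 1%nat) (a 2%nat) (a 3%nat).
Proof.
  intros Ha; exists (pser (fun n => a (S (S (S (S n)))))).
  pose proof (radius1_shift _ Ha) as A1; pose proof (radius1_shift _ A1) as A2.
  pose proof (radius1_shift _ A2) as A3; pose proof (radius1_shift _ A3) as A4.
  split; [now apply (hol_pser _ A4 _ inD_0 0%nat)|].
  eapply near_imp; [|apply near_inD, inD_0]; intros z Hz.
  rewrite (pser_shift _ z Ha Hz), (pser_shift _ z A1 Hz), (pser_shift _ z A2 Hz),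
    (pser_shift _ z A3 Hz); reflexivity.
Qed.

(** Let z tend to 0. The point z = 0 is excluded from the hypothesis because the identity will come
    from a division by z. *)
Lemma bounded_remainder_zero (c : C) (e : C -> C) : taylor 0 (RtoC 0) e ->
  near (RtoC 0) (fun z => z <> RtoC 0 -> (c + z * e z = 0)%C) -> c = RtoC 0.
Proof.
  intros He H; destruct (taylor_bounded 0 _ _ He) as [K [HK0 HK]].
  destruct (near_and _ _ _ H HK) as [d [Hd HH]].
  destruct (Req_dec (Cmod c) 0) as [E|Hn]; [now apply Cmod_eq_0|exfalso].
  pose proof (Cmod_ge_0 c).
  set (t := Rmin (d / 2) (Cmod c / (2 * K))).
  assert (Ht : 0 < t) by (apply Rmin_pos; [lra|apply Rdiv_lt_0_compat; lra]).
  assert (Ht1 : t <= d / 2) by apply Rmin_l.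
  assert (Ht2 : t * K <= Cmod c / 2).
  { apply Rle_trans with (Cmod c / (2 * K) * K); [|right; field; lra].
    apply Rmult_le_compat_r; [lra|apply Rmin_r]. }
  destruct (HH (RtoC t)) as [H1 H2].
  { replace (RtoC t - RtoC 0)%C with (RtoC t) by ring; rewrite Cmod_R, Rabs_right; lra. }
  assert (Hc : c = (- (RtoC t * e (RtoC t)))%C).
  { replace c with (c + RtoC t * e (RtoC t) - RtoC t * e (RtoC t))%C at 1 by ring.
    rewrite H1; [ring|]; intros E; apply RtoC_inj in E; lra. }
  apply (f_equal Cmod) in Hc; rewrite Cmod_opp, Cmod_mult, Cmod_R, (Rabs_right t) in Hc by lra.
  nra.
Qed.

Lemma jet_unique (f g : C -> C) (c0 c1 c2 c3 d0 d1 d2 d3 : C) :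
  jet f c0 c1 c2 c3 -> jet g d0 d1 d2 d3 -> near (RtoC 0) (fun z => f z = g z) ->
  c0 = d0 /\ c1 = d1 /\ c2 = d2 /\ c3 = d3.
Proof.
  intros Hf Hg Heq.
  assert (Hx : forall x y : C, (x + - RtoC 1 * y)%C = RtoC 0 -> x = y).
  { intros x y E; replace x with ((x + - RtoC 1 * y) + y)%C by ring; rewrite E; ring. }
  destruct (jet_plus _ _ _ _ _ _ _ _ _ _ Hf (jet_mult _ _ _ _ _ _ _ _ _ _ (jet_const (- RtoC 1)) Hg))
    as [e [He E]].
  revert E.
  set (x0 := (c0 + _)%C); set (x1 := (c1 + _)%C); set (x2 := (c2 + _)%C); set (x3 := (c3 + _)%C).
  intros E.
  assert (E' : near (RtoC 0) (fun z => (x0 + z * (x1 + z * (x2 + z * (x3 + z * e z))) = 0)%C)).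
  { eapply near_imp; [|apply (near_and _ _ _ Heq E)].
    intros z [Z1 Z2]; simpl in Z1, Z2; rewrite <- Z2, Z1; ring. }
  assert (B3 : taylor 0 (RtoC 0) (fun z => x3 + z * e z)%C)
    by (apply taylor_plus; [|apply taylor_mult]; auto using taylor_const, taylor_id).
  assert (B2 : taylor 0 (RtoC 0) (fun z => x2 + z * (x3 + z * e z))%C)
    by (apply taylor_plus; [|apply taylor_mult]; auto using taylor_const, taylor_id).
  assert (B1 : taylor 0 (RtoC 0) (fun z => x1 + z * (x2 + z * (x3 + z * e z)))%C)
    by (apply taylor_plus; [|apply taylor_mult]; auto using taylor_const, taylor_id).
  assert (Hdiv : forall z x : C, z <> RtoC 0 -> (z * x = 0)%C -> x = RtoC 0).
  { intros z x Hz Hzx; replace x with ((z * x) / z)%C by (field; exact Hz).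
    rewrite Hzx; unfold Cdiv; ring. }
  assert (Z0 : x0 = RtoC 0).
  { apply (bounded_remainder_zero _ _ B1); eapply near_imp; [|exact E']; auto. }
  assert (E1 : near (RtoC 0) (fun z => z <> RtoC 0 ->
     (x1 + z * (x2 + z * (x3 + z * e z)) = 0)%C)).
  { eapply near_imp; [|exact E']; intros z Hz Hn; apply (Hdiv z _ Hn).
    rewrite <- Hz, Z0; ring. }
  assert (Z1 : x1 = RtoC 0) by exact (bounded_remainder_zero _ _ B2 E1).
  assert (E2 : near (RtoC 0) (fun z => z <> RtoC 0 -> (x2 + z * (x3 + z * e z) = 0)%C)).
  { eapply near_imp; [|exact E1]; intros z Hz Hn; apply (Hdiv z _ Hn).
    rewrite <- (Hz Hn), Z1; ring. }
  assert (Z2 : x2 = RtoC 0) by exact (bounded_remainder_zero _ _ B3 E2).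
  assert (E3 : near (RtoC 0) (fun z => z <> RtoC 0 -> (x3 + z * e z = 0)%C)).
  { eapply near_imp; [|exact E2]; intros z Hz Hn; apply (Hdiv z _ Hn).
    rewrite <- (Hz Hn), Z2; ring. }
  assert (Z3 : x3 = RtoC 0) by exact (bounded_remainder_zero _ _ He E3).
  unfold x0, x1, x2, x3 in *; repeat split; apply Hx.
  - exact Z0.
  - rewrite <- Z1; ring.
  - rewrite <- Z2; ring.
  - rewrite <- Z3; ring.
Qed.

(** * The coefficient bounds *)

Lemma derive_ext_near (f g : C -> C) (z d : C) : near z (fun y => f y = g y) ->
  @is_derive C_AbsRing C_NormedModule f z d -> @is_derive C_AbsRing C_NormedModule g z d.
Proof.
  intros E H; apply is_derive_near; intros eps Heps.
  pose proof (near_self _ _ E) as Ez; simpl in Ez.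
  eapply near_imp; [|apply (near_and _ _ _ E (proj1 (is_derive_near f z d) H eps Heps))].
  intros y [E1 E2]; now rewrite <- E1, <- Ez.
Qed.

Lemma pser_0 (a : nat -> C) : radius1 a -> pser a (RtoC 0) = a 0%nat.
Proof. intros Ha; rewrite (pser_shift a _ Ha inD_0); ring. Qed.

(* The equation z f' = f xi(w) after division by z, which also covers z = 0. *)
Lemma S_star_equation (f : C -> C) (a : nat -> C) : S_star_xi f -> coeffs_of f a ->
  a 1%nat = RtoC 1 /\
  exists w, (forall z, inD z -> cont w z) /\ w (RtoC 0) = RtoC 0 /\
    (forall z, inD z -> inD (w z)) /\
    forall z, inD z -> pser (fun n => a (S n)) z <> RtoC 0 /\
      pser (dcoef a) z = (pser (fun n => a (S n)) z * xi (w z))%C.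
Proof.
  intros [[_ [f0 f1]] [w [Hw [w0 [wD Hxi]]]]] Hfa.
  pose proof (coeffs_radius1 f a Hfa) as Ha.
  pose proof (radius1_shift _ Ha) as Ha'.
  assert (Hnear : forall z, inD z -> near z (fun y => pser a y = f y)).
  { intros z Hz; eapply near_imp; [|apply near_inD, Hz]; intros y Hy.
    symmetry; now apply coeffs_pser. }
  assert (Hder : forall z, inD z ->
    @is_derive C_AbsRing C_NormedModule f z (pser (dcoef a) z)).
  { intros z Hz; eapply derive_ext_near; [apply Hnear, Hz|]; now apply is_derive_pser. }
  assert (a0 : a 0%nat = RtoC 0).
  { rewrite <- (pser_0 a Ha), <- (coeffs_pser f a _ Hfa inD_0); exact f0. }
  assert (a1 : a 1%nat = RtoC 1).
  { pose proof (derive_unique _ _ _ _ f1 (Hder _ inD_0)) as E.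
    rewrite (pser_0 _ (radius1_dcoef _ Ha)) in E; rewrite E.
    unfold dcoef; simpl (INR 1); ring. }
  split; [exact a1|]; exists w; repeat split; auto.
  - intros z Hz; destruct (Hw z Hz) as [d Hd]; exact (derive_cont _ _ _ Hd).
  - destruct (excluded_middle_informative (z = RtoC 0)) as [->|Hn].
    + rewrite (pser_0 _ Ha'), a1; intros E; apply RtoC_inj in E; lra.
    + destruct (Hxi z H Hn) as [N _]; intros E; apply N.
      rewrite (coeffs_pser f a z Hfa H), (pser_shift a z Ha H), a0, E; ring.
  - destruct (excluded_middle_informative (z = RtoC 0)) as [->|Hn].
    + rewrite (pser_0 _ Ha'), (pser_0 _ (radius1_dcoef _ Ha)), a1, w0.
      rewrite (xi_pser _ inD_0), (pser_0 _ radius1_sinC).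
      unfold dcoef, sinC; rewrite a1; simpl; replace (sin_coef 0) with 0 by reflexivity.
      field; intros E; apply RtoC_inj in E; lra.
    + destruct (Hxi z H Hn) as [N Hq].
      rewrite <- (Hq _ (Hder z H)).
      assert (Ef : f z = (z * pser (fun n => a (S n)) z)%C).
      { rewrite (coeffs_pser f a z Hfa H), (pser_shift a z Ha H), a0; ring. }
      rewrite Ef; rewrite Ef in N; field; split; [|exact Hn].
      intros E; apply N; rewrite E; ring.
Qed.

Lemma sin_coef_values :
  sin_coef 0 = 0 /\ sin_coef 1 = 1 /\ sin_coef 2 = 0 /\ sin_coef 3 = - / 6.
Proof. unfold sin_coef; simpl; repeat split; lra. Qed.

Lemma jet_ext (f g : C -> C) (c0 c1 c2 c3 : C) : near (RtoC 0) (fun z => f z = g z) ->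
  jet f c0 c1 c2 c3 -> jet g c0 c1 c2 c3.
Proof.
  intros E [e [He Ee]]; exists e; split; [exact He|].
  eapply near_imp; [|apply (near_and _ _ _ E Ee)]; intros z [E1 E2]; now rewrite <- E1.
Qed.

Lemma jet_eq (f : C -> C) (c0 c1 c2 c3 d0 d1 d2 d3 : C) : jet f c0 c1 c2 c3 ->
  c0 = d0 -> c1 = d1 -> c2 = d2 -> c3 = d3 -> jet f d0 d1 d2 d3.
Proof. intros H <- <- <- <-; exact H. Qed.

(** Only w - w^3/6 matters: writing w = z q, the rest w^4 T(w) is z^4 times a function bounded near
    0, so its jet is zero. *)
Lemma jet_sin_comp (w : C -> C) (k1 k2 k3 : C) : hol w -> (forall z, inD z -> inD (w z)) ->
  w (RtoC 0) = RtoC 0 -> jet w (RtoC 0) k1 k2 k3 ->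
  jet (fun z => pser sinC (w z)) (RtoC 0) k1 k2 (k3 - RtoC (/ 6) * (k1 * k1 * k1))%C.
Proof.
  intros Hw HD w0 Hj.
  pose proof radius1_sinC as A0; pose proof (radius1_shift _ A0) as A1.
  pose proof (radius1_shift _ A1) as A2; pose proof (radius1_shift _ A2) as A3.
  pose proof (radius1_shift _ A3) as A4.
  set (T := pser (fun n => sinC (S (S (S (S n)))))).
  assert (HT : jet (fun z => w z * w z * (w z * w z) * T (w z))%C
                 (RtoC 0) (RtoC 0) (RtoC 0) (RtoC 0)).
  { destruct (hol_quotient w Hw) as [q [Hq Eq]].
    exists (fun z => q z * q z * (q z * q z) * T (w z))%C; split.
    - repeat apply taylor_mult; try apply (Hq _ inD_0 0%nat).
      apply taylor_comp; [apply hol_cont; auto using inD_0|apply Hw, inD_0|].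
      rewrite w0; apply (hol_pser _ A4 _ inD_0).
    - apply near_true; intros z; rewrite (Eq z), w0 at 1 2 3 4.
      generalize (T (w z)); intros t; ring. }
  assert (H3 := jet_mult _ _ _ _ _ _ _ _ _ _ (jet_const (RtoC (- / 6)))
                  (jet_mult _ _ _ _ _ _ _ _ _ _ Hj (jet_mult _ _ _ _ _ _ _ _ _ _ Hj Hj))).
  pose proof (jet_plus _ _ _ _ _ _ _ _ _ _ Hj (jet_plus _ _ _ _ _ _ _ _ _ _ H3 HT)) as H.
  eapply jet_ext; [|eapply jet_eq; [exact H|..]]; try ring.
  - eapply near_imp; [|apply near_inD, inD_0]; intros z Hz; simpl.
    specialize (HD z Hz).
    rewrite (pser_shift _ _ A0 HD), (pser_shift _ _ A1 HD), (pser_shift _ _ A2 HD),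
      (pser_shift _ _ A3 HD).
    unfold sinC at 1 2 3 4.
    destruct sin_coef_values as [V0 [V1 [V2 V3]]]; rewrite V0, V1, V2, V3.
    fold T; generalize (T (w z)); intros t; ring.
  - rewrite RtoC_opp; ring.
Qed.

Lemma coefficient_relations (a : nat -> C) (w : C -> C) (k1 k2 k3 : C) :
  radius1 a -> a 1%nat = RtoC 1 -> hol w -> (forall z, inD z -> inD (w z)) ->
  w (RtoC 0) = RtoC 0 -> jet w (RtoC 0) k1 k2 k3 ->
  (forall z, inD z -> pser (dcoef a) z = (pser (fun n => a (S n)) z * xi (w z))%C) ->
  a 2%nat = k1 /\ (RtoC 2 * a 3%nat)%C = (k2 + RtoC 2 * (k1 * k1))%C /\
  (RtoC 3 * a 4%nat)%C = (k3 + RtoC (7 / 2) * (k1 * k2) + RtoC (17 / 6) * (k1 * k1 * k1))%C.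
Proof.
  intros Ha a1 Hw HD w0 Hj Heq.
  pose proof (radius1_shift _ Ha) as Ha'; pose proof (radius1_dcoef _ Ha) as Had.
  pose proof (jet_pser _ Ha') as J0; pose proof (jet_pser _ Had) as J1.
  pose proof (jet_mult _ _ _ _ _ _ _ _ _ _ (jet_const (- RtoC 1)) J0) as J0'.
  pose proof (jet_mult _ _ _ _ _ _ _ _ _ _ (jet_const (- RtoC 1)) Hj) as Jw.
  pose proof (jet_mult _ _ _ _ _ _ _ _ _ _
    (jet_plus _ _ _ _ _ _ _ _ _ _ J1 J0')
    (jet_plus _ _ _ _ _ _ _ _ _ _ (jet_const (RtoC 1)) Jw)) as JL.
  pose proof (jet_mult _ _ _ _ _ _ _ _ _ _ J0 (jet_sin_comp w _ _ _ Hw HD w0 Hj)) as JR.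
  destruct (jet_unique _ _ _ _ _ _ _ _ _ _ JL JR) as [_ [R1 [R2 R3]]].
  { eapply near_imp; [|apply near_inD, inD_0]; intros z Hz; simpl.
    rewrite (Heq z Hz), xi_pser by auto.
    pose proof (inD_neq_1 _ (HD z Hz)); field; assumption. }
  unfold dcoef in R1, R2, R3; rewrite a1 in R1, R2, R3.
  replace (INR 1) with 1 in R1, R2, R3 by (simpl; ring).
  replace (INR 2) with 2 in R1, R2, R3 by (simpl; ring).
  replace (INR 3) with 3 in R2, R3 by (simpl; ring).
  replace (INR 4) with 4 in R3 by (simpl; ring).
  (* Each relation differs from a coefficient identity by rearrangement only, so [ring] has to
     compare just the two differences. *)
  assert (Hx : forall x y l r : C, l = r -> (x - y = l - r)%C -> x = y).
  { intros x y l r -> E; replace x with ((x - y) + y)%C by ring; rewrite E; ring. }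
  assert (E2 : a 2%nat = k1) by (apply (Hx _ _ _ _ R1); ring).
  split; [exact E2|]; rewrite E2 in R2, R3.
  assert (E3 : (RtoC 2 * a 3%nat = k2 + RtoC 2 * (k1 * k1))%C).
  { apply (Hx _ _ _ _ R2). ring. }
  split; [exact E3|]; apply (Hx _ _ _ _ R3).
  assert (E3' : (a 3%nat = RtoC (/ 2) * (k2 + RtoC 2 * (k1 * k1)))%C).
  { rewrite <- E3, Cmult_assoc, <- RtoC_mult; replace (/ 2 * 2) with 1 by field; ring. }
  rewrite E3'.
  (* Passing to real components lets [field] evaluate the rational constants hidden under [RtoC]. *)
  apply injective_projections; simpl; field.
Qed.

(** Removes the factor r: the coefficients of r w are r k1, r k2, r k3, so the parts of the
    functionals of degree 1, 2, 3 in these pick up r, r^2, r^3. *)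
Lemma cubic_limit_bound (x y v : C) (B : R) :
  (forall r, 0 < r < 1 -> Cmod (RtoC r * x + RtoC (r * r) * y + RtoC (r * r * r) * v) <= B) ->
  Cmod (x + y + v) <= B.
Proof.
  intros H; destruct (Rle_lt_dec (Cmod (x + y + v)) B) as [|Hlt]; [assumption|exfalso].
  pose proof (Cmod_ge_0 x); pose proof (Cmod_ge_0 y); pose proof (Cmod_ge_0 v).
  (* With r = 1 - s, each of 1 - r, 1 - r^2, 1 - r^3 is at most 3 s. *)
  set (K := 3 * (Cmod x + Cmod y + Cmod v) + 1).
  assert (HK : 0 < K) by (unfold K; lra).
  set (s := Rmin (1 / 2) ((Cmod (x + y + v) - B) / (2 * K))).
  assert (Hs : 0 < s <= 1 / 2).
  { split; [apply Rmin_pos; [lra|apply Rdiv_lt_0_compat; lra]|apply Rmin_l]. }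
  assert (HsK : s * K <= (Cmod (x + y + v) - B) / 2).
  { apply Rle_trans with ((Cmod (x + y + v) - B) / (2 * K) * K).
    - apply Rmult_le_compat_r; [lra|apply Rmin_r].
    - right; field; lra. }
  specialize (H (1 - s) ltac:(lra)).
  pose proof (Cmod_le_plus_minus (x + y + v)%C (RtoC (1 - s) * x + RtoC ((1 - s) * (1 - s)) * y +
     RtoC ((1 - s) * (1 - s) * (1 - s)) * v)%C) as T.
  match type of T with _ <= _ + Cmod ?d =>
    replace d with (RtoC s * x + (RtoC (s * (2 - s)) * y + RtoC (s * (3 - 3 * s + s * s)) * v))%C in T
      by (apply injective_projections; simpl; ring) end.
  pose proof (Cmod_triangle (RtoC s * x) (RtoC (s * (2 - s)) * y + RtoC (s * (3 - 3 * s + s * s)) * v)) as T1.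
  pose proof (Cmod_triangle (RtoC (s * (2 - s)) * y) (RtoC (s * (3 - 3 * s + s * s)) * v)) as T2.
  rewrite !Cmod_mult, !Cmod_R, !Rabs_right in T1 by nra.
  rewrite !Cmod_mult, !Cmod_R, !Rabs_right in T2 by nra.
  assert (s * (2 - s) * Cmod y <= s * (3 * Cmod y)) by nra.
  assert (s * (3 - 3 * s + s * s) * Cmod v <= s * (3 * Cmod v)).
  { assert (3 - 3 * s + s * s <= 3) by nra.
    rewrite Rmult_assoc; apply Rmult_le_compat_l; [lra|]; now apply Rmult_le_compat_r. }
  unfold K in HsK; nra.
Qed.

Lemma coefficient_bounds (f : C -> C) (a : nat -> C) : S_star_xi f -> coeffs_of f a ->
  Cmod (a 2%nat) <= 1 /\ Cmod (a 3%nat) <= 1 /\ Cmod (a 4%nat) <= 17 / 18.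
Proof.
  intros Hf Hfa; pose proof (coeffs_radius1 f a Hfa) as Ha.
  destruct (S_star_equation f a Hf Hfa) as [a1 [w [Hc [w0 [HD HE]]]]].
  assert (Hw : hol w).
  { apply (hol_subordinate w (dcoef a) (fun n => a (S n)));
      auto using radius1_shift, radius1_dcoef. }
  (* Defined from the coefficients of [f], hence independent of r, whereas c, g, d change with r. *)
  set (k2 := (RtoC 2 * a 3%nat - RtoC 2 * (a 2%nat * a 2%nat))%C).
  set (k3 := (RtoC 3 * a 4%nat - RtoC (7 / 2) * (a 2%nat * k2)
              - RtoC (17 / 6) * (a 2%nat * a 2%nat * a 2%nat))%C).
  assert (Key : forall r, 0 < r < 1 -> exists c g d, Cmod c <= 1 /\ Cmod g <= 1 /\ Cmod d <= 1 /\
    c = (RtoC r * a 2%nat)%C /\ ((1 - c * Cconj c) * g)%C = (RtoC r * k2)%C /\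
    ((1 - c * Cconj c) * ((1 - g * Cconj g) * d - Cconj c * (g * g)))%C = (RtoC r * k3)%C).
  { intros r Hr.
    destruct (schwarz_coefficients w r Hw) as [c [g [d [psi [C1 [C2 [C3 [Hpsi [P0 Hpw]]]]]]]]];
      [intros z Hz; apply Rlt_le, HD, Hz|exact w0|lra|].
    exists c, g, d; do 3 (split; [assumption|]).
    set (c2 := ((1 - c * Cconj c) * g)%C) in *.
    set (c3 := ((1 - c * Cconj c) * _)%C) in *.
    assert (Hr0 : RtoC r <> RtoC 0) by (intros E; apply RtoC_inj in E; lra).
    assert (Hj : jet w (RtoC 0) (c / RtoC r) (c2 / RtoC r) (c3 / RtoC r)).
    { destruct (hol_quotient psi Hpsi) as [q [Hq Eq]].
      exists (fun z => q z / RtoC r)%C; split.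
      - apply taylor_mult; [apply (Hq _ inD_0 0%nat)|apply taylor_const].
      - eapply near_imp; [|apply near_inD, inD_0]; intros z Hz.
        replace (w z) with ((RtoC r * w z) / RtoC r)%C by (field; exact Hr0).
        rewrite (Hpw z Hz), (Eq z), P0; field; exact Hr0. }
    destruct (coefficient_relations a w _ _ _ Ha a1 Hw HD w0 Hj) as [R1 [R2 R3]].
    { intros z Hz; apply HE, Hz. }
    split; [rewrite R1; field; exact Hr0|].
    assert (K2 : k2 = (c2 / RtoC r)%C) by (unfold k2; rewrite R2, R1; ring).
    assert (K3 : k3 = (c3 / RtoC r)%C) by (unfold k3; rewrite R3, K2, R1; ring).
    split; [rewrite K2|rewrite K3]; field; exact Hr0. }
  split; [|split].
  - replace (a 2%nat) with (a 2%nat + RtoC 0 + RtoC 0)%C by ring.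
    apply cubic_limit_bound; intros r Hr.
    destruct (Key r Hr) as [c [_ [_ [Hc1 [_ [_ [Ec _]]]]]]].
    rewrite !Cmult_0_r, !Cplus_0_r, <- Ec; exact Hc1.
  - assert (H2 : Cmod (RtoC 2 * a 3%nat) <= 2).
    { replace (RtoC 2 * a 3%nat)%C with (k2 + RtoC 2 * (a 2%nat * a 2%nat) + RtoC 0)%C
        by (unfold k2; ring).
      apply cubic_limit_bound; intros r Hr.
      destruct (Key r Hr) as [c [g [d [Hc1 [Hg [_ [Ec [E2 _]]]]]]]].
      pose proof (second_functional_bound c g Hc1 Hg) as B; rewrite E2, Ec in B.
      eapply Rle_trans; [right|exact B]; f_equal; rewrite RtoC_mult; ring. }
    rewrite Cmod_mult, Cmod_R, Rabs_right in H2 by lra; lra.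
  - assert (H3 : Cmod (RtoC 3 * a 4%nat) <= 17 / 6).
    { replace (RtoC 3 * a 4%nat)%C with (k3 + RtoC (7 / 2) * (a 2%nat * k2)
        + RtoC (17 / 6) * (a 2%nat * a 2%nat * a 2%nat))%C by (unfold k3; ring).
      apply cubic_limit_bound; intros r Hr.
      destruct (Key r Hr) as [c [g [d [Hc1 [Hg [Hd [Ec [E2 E3]]]]]]]].
      pose proof (third_functional_bound c g d Hc1 Hg Hd) as B; rewrite E2, E3, Ec in B.
      eapply Rle_trans; [right|exact B]; f_equal; rewrite !RtoC_mult; ring. }
    rewrite Cmod_mult, Cmod_R, Rabs_right in H3 by lra; lra.
Qed.

(** * The extremal function *)

(* Coefficients of (xi(z) - 1) / z = sin z / (z (1 - z)): partial sums of those of sin. *)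
Fixpoint xi_coef (n : nat) : R :=
  match n with
  | O => 1
  | S m => xi_coef m + sin_coef (S n)
  end.

Lemma xi_coef_odd (k : nat) : xi_coef (2 * k + 1) = xi_coef (2 * k).
Proof.
  replace (2 * k + 1)%nat with (S (2 * k)) by lia; simpl xi_coef.
  replace (S (S (k + (k + 0)))) with (2 * S k)%nat by lia; rewrite sin_coef_even.
  simpl (2 * k)%nat; ring.
Qed.

(* Alternating series: the partial sums stay in [0, 1], with the last term as margin. *)
Lemma xi_coef_bound_even (k : nat) :
  (1 + (-1) ^ k) / 2 * / INR (fact (2 * k + 1)) <= xi_coef (2 * k)
    <= 1 - (1 - (-1) ^ k) / 2 * / INR (fact (2 * k + 1)).
Proof.
  induction k as [|k IH]; [simpl; split; lra|].
  assert (E : xi_coef (2 * S k) = xi_coef (2 * k) + (-1) ^ S k / INR (fact (2 * S k + 1))).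
  { rewrite <- sin_coef_odd, <- (xi_coef_odd k).
    replace (2 * S k + 1)%nat with (S (S (2 * k + 1))) by lia.
    now replace (2 * S k)%nat with (S (2 * k + 1)) by lia. }
  rewrite E; clear E.
  assert (Ht : 0 < / INR (fact (2 * S k + 1)) <= / INR (fact (2 * k + 1))).
  { split; [apply Rinv_0_lt_compat, INR_fact_lt_0|].
    apply Rinv_le_contravar; [apply INR_fact_lt_0|].
    apply le_INR, fact_le; lia. }
  assert (He : (-1) ^ k = 1 \/ (-1) ^ k = -1).
  { clear; induction k as [|k [IH|IH]]; simpl; [left; reflexivity|rewrite IH..]; lra. }
  unfold Rdiv; rewrite <- tech_pow_Rmult.
  revert IH Ht; generalize (/ INR (fact (2 * k + 1))), (/ INR (fact (2 * S k + 1))).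
  intros t s IH Ht; destruct He as [He|He]; rewrite He in *; split; lra.
Qed.

Lemma xi_coef_bound (n : nat) : Rabs (xi_coef n) <= 1.
Proof.
  assert (H : forall k, 0 <= xi_coef (2 * k) <= 1).
  { intros k; pose proof (xi_coef_bound_even k) as B.
    assert (Ht : 0 < / INR (fact (2 * k + 1))) by apply Rinv_0_lt_compat, INR_fact_lt_0.
    assert (He : -1 <= (-1) ^ k <= 1) by (apply Rabs_le_between; rewrite pow_1_abs; lra).
    nra. }
  apply Rabs_le; destruct (parity_cases n) as [k [->| ->]];
    [|rewrite xi_coef_odd]; specialize (H k); lra.
Qed.

Definition xiC (n : nat) : C := RtoC (xi_coef n).

Lemma radius1_xiC : radius1 xiC.
Proof. apply radius1_bounded with 1; intros n; unfold xiC; rewrite Cmod_R; apply xi_coef_bound. Qed.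

(** The recursion of [xi_coef] says X = 1 + z (X + tail of sin), that is (1 - z) X = sin z / z. *)
Lemma xi_expansion (z : C) : inD z -> xi z = (1 + z * pser xiC z)%C.
Proof.
  intros Hz; rewrite xi_pser by exact Hz.
  pose proof radius1_xiC as Hx; pose proof radius1_sinC as Hs.
  pose proof (radius1_shift _ Hs) as Hs1; pose proof (radius1_shift _ Hs1) as Hs2.
  assert (E : pser xiC z =
    (1 + z * (pser xiC z + pser (fun n => sinC (S (S n))) z))%C).
  { rewrite <- (pser_plus _ _ z Hx Hs2 Hz).
    rewrite (pser_shift _ z Hx Hz) at 1; unfold xiC at 1; simpl xi_coef.
    do 2 f_equal; apply pser_ext; intros n; unfold xiC, sinC; simpl xi_coef.
    apply RtoC_plus. }
  rewrite (pser_shift _ z Hs Hz), (pser_shift _ z Hs1 Hz).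
  replace (sinC 0) with (RtoC 0) by reflexivity.
  replace (sinC 1) with (RtoC 1)
    by (unfold sinC; destruct sin_coef_values as [_ [-> _]]; reflexivity).
  replace (1 + z * pser (fun n => sinC (S (S n))) z)%C with (pser xiC z - z * pser xiC z)%C
    by (rewrite E at 1; ring).
  field; now apply inD_neq_1.
Qed.

(* [(n+1) f_(n+1) = sum_(k <= n) f_k xi_(n-k)], solved up to index n by [ode_table n]. *)
Fixpoint ode_table (n : nat) : nat -> C :=
  match n with
  | O => fun _ => RtoC 1
  | S m => fun k => if Nat.leb k m then ode_table m k
                    else (RtoC (/ INR (S m)) * conv (ode_table m) xiC m)%C
  end.

Definition ode_coef (n : nat) : C := ode_table n n.

Lemma ode_table_stable (m k : nat) : (k <= m)%nat -> ode_table m k = ode_coef k.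
Proof.
  induction m as [|m IH]; intros H.
  - now replace k with 0%nat by lia.
  - destruct (Nat.eq_dec k (S m)) as [->|Hk]; [reflexivity|].
    cbn [ode_table]; destruct (Nat.leb_spec k m); [now apply IH|lia].
Qed.

Lemma conv_ext (u u' v : nat -> C) (n : nat) :
  (forall k, (k <= n)%nat -> u k = u' k) -> conv u v n = conv u' v n.
Proof. intros H; apply sum_n_ext_loc; intros k Hk; now rewrite H. Qed.

Lemma ode_coef_S (n : nat) : ode_coef (S n) = (RtoC (/ INR (S n)) * conv ode_coef xiC n)%C.
Proof.
  unfold ode_coef at 1; cbn [ode_table].
  destruct (Nat.leb_spec (S n) n); [lia|].
  now rewrite (conv_ext (ode_table n) ode_coef) by (intros; now apply ode_table_stable).
Qed.

Lemma conv_bound (u v : nat -> C) (n : nat) :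
  (forall k, (k <= n)%nat -> Cmod (u k) <= 1) -> (forall k, Cmod (v k) <= 1) ->
  Cmod (conv u v n) <= INR (S n).
Proof.
  intros Hu Hv; unfold conv.
  assert (H : forall N, (N <= n)%nat ->
    Cmod (sum_n (G := C_NormedModule) (fun k => u k * v (n - k)%nat)%C N) <= INR (S N));
    [|now apply H].
  assert (Ht : forall k, (k <= n)%nat -> Cmod (u k * v (n - k)%nat) <= 1).
  { intros k Hk; rewrite Cmod_mult; pose proof (Hu k Hk); pose proof (Hv (n - k)%nat).
    pose proof (Cmod_ge_0 (u k)); pose proof (Cmod_ge_0 (v (n - k)%nat)); nra. }
  induction N as [|N IH]; intros HN.
  - rewrite sum_O; simpl; apply Ht; lia.
  - rewrite sum_Sn; eapply Rle_trans; [apply Cmod_triangle|].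
    rewrite S_INR; apply Rplus_le_compat; [apply IH; lia|apply Ht; lia].
Qed.

(** The recursion averages n + 1 products of modulus at most 1, since [xi_coef] is bounded by 1. *)
Lemma ode_coef_bound (n : nat) : Cmod (ode_coef n) <= 1.
Proof.
  induction n as [n IH] using Wf_nat.lt_wf_ind; destruct n as [|n].
  - unfold ode_coef; simpl; rewrite Cmod_1; lra.
  - rewrite ode_coef_S, Cmod_mult, Cmod_R.
    assert (Hn : 0 < INR (S n)) by (apply lt_0_INR; lia).
    rewrite Rabs_right by (left; now apply Rinv_0_lt_compat).
    apply Rmult_le_reg_l with (INR (S n)); [exact Hn|].
    rewrite <- Rmult_assoc, Rinv_r, Rmult_1_l, Rmult_1_r by lra.
    apply conv_bound; [intros k Hk; apply IH; lia|].
    intros k; unfold xiC; rewrite Cmod_R; apply xi_coef_bound.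
Qed.

Lemma radius1_ode_coef : radius1 ode_coef.
Proof. exact (radius1_bounded _ _ ode_coef_bound). Qed.

(** For h = f / z, the equation z f' = f xi becomes h' = h (xi - 1) / z. *)
Lemma ode_equation (z : C) : inD z ->
  pser (dcoef ode_coef) z = (pser ode_coef z * pser xiC z)%C.
Proof.
  intros Hz; rewrite <- pser_mult by (auto using radius1_ode_coef, radius1_xiC).
  apply pser_ext; intros n; unfold dcoef; rewrite ode_coef_S, Cmult_assoc, <- RtoC_mult.
  rewrite Rinv_r by (apply not_0_INR; lia); ring.
Qed.

Lemma is_derive_along_ray (g : C -> C) (z d : C) (t : R) :
  @is_derive C_AbsRing C_NormedModule g (RtoC t * z)%C d ->
  is_derive (fun s => fst (g (RtoC s * z)%C)) t (fst (z * d)%C) /\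
  is_derive (fun s => snd (g (RtoC s * z)%C)) t (snd (z * d)%C).
Proof.
  intros H; pose proof (Cmod_ge_0 z) as Hz.
  assert (K : forall eps, 0 < eps -> exists del : posreal, forall h, h <> 0 -> Rabs h < del ->
    Cmod (g (RtoC (t + h) * z)%C - g (RtoC t * z)%C - RtoC h * (z * d)) < eps * Rabs h).
  { intros eps He.
    (* The factor 2 makes the final inequality strict, and the + 1 covers z = 0. *)
    destruct (proj1 (is_derive_near _ _ _) H (eps / (2 * (Cmod z + 1)))) as [e [He0 HH]].
    { apply Rdiv_lt_0_compat; lra. }
    assert (Hp : 0 < e / (Cmod z + 1)) by (apply Rdiv_lt_0_compat; lra).
    exists (mkposreal _ Hp); intros h Hh0 Hh; simpl in Hh.
    pose proof (Rabs_pos_lt h Hh0) as Hh1.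
    assert (Hy : (RtoC (t + h) * z - RtoC t * z = RtoC h * z)%C) by (rewrite RtoC_plus; ring).
    specialize (HH (RtoC (t + h) * z)%C); rewrite Hy, Cmod_mult, Cmod_R in HH.
    apply Rmult_lt_compat_r with (r := Cmod z + 1) in Hh; [|lra].
    replace (e / (Cmod z + 1) * (Cmod z + 1)) with e in Hh by (field; lra).
    replace (RtoC h * (z * d))%C with (RtoC h * z * d)%C by ring.
    eapply Rle_lt_trans; [apply HH; nra|].
    apply Rmult_lt_reg_r with (2 * (Cmod z + 1)); [lra|].
    replace (eps / (2 * (Cmod z + 1)) * (Rabs h * Cmod z) * (2 * (Cmod z + 1)))
      with (eps * Rabs h * Cmod z) by (field; lra).
    assert (0 < eps * Rabs h) by (apply Rmult_lt_0_compat; lra); nra. }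
  assert (Hdiv : forall A B D h eps, h <> 0 -> Rabs (A - B - h * D) < eps * Rabs h ->
    Rabs ((A - B) / h - D) < eps).
  { intros A B D h eps Hh HA.
    replace ((A - B) / h - D) with ((A - B - h * D) / h) by (field; exact Hh).
    pose proof (Rabs_pos_lt h Hh).
    unfold Rdiv; rewrite Rabs_mult, Rabs_inv.
    apply Rmult_lt_reg_r with (Rabs h); [assumption|].
    rewrite Rmult_assoc, Rinv_l, Rmult_1_r by lra; exact HA. }
  split; apply is_derive_Reals; intros eps He; destruct (K eps He) as [del Hdel];
    exists del; intros h Hh0 Hh; specialize (Hdel h Hh0 Hh); apply Hdiv; try exact Hh0;
    (eapply Rle_lt_trans; [|exact Hdel]).
  - eapply Rle_trans; [|apply re_le_Cmod]; right; f_equal; simpl; ring.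
  - eapply Rle_trans; [|apply im_le_Cmod]; right; f_equal; simpl; ring.
Qed.

(* Gronwall along the ray [0, z]: |f(tz)|^2 exp(2Kt) is nondecreasing when K bounds |g|. *)
Lemma linear_ode_nonvanishing (f df g : C -> C) (z : C) (K : R) : inD z ->
  (forall y, inD y -> @is_derive C_AbsRing C_NormedModule f y (df y)) ->
  (forall y, inD y -> df y = (f y * g y)%C) ->
  (forall y, Cmod y <= Cmod z -> Cmod (g y) <= K) ->
  f (RtoC 0) <> RtoC 0 -> f z <> RtoC 0.
Proof.
  intros Hz Hd Hode HK H0 Hfz; unfold inD in *; pose proof (Cmod_ge_0 z) as Hz0.
  set (u := fun s => fst (f (RtoC s * z)%C)); set (v := fun s => snd (f (RtoC s * z)%C)).
  set (phi := fun s => (u s * u s + v s * v s) * exp (2 * K * s)).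
  set (dphi := fun s => (2 * (u s * fst (z * df (RtoC s * z))%C + v s * snd (z * df (RtoC s * z))%C)
                         + 2 * K * (u s * u s + v s * v s)) * exp (2 * K * s)).
  assert (Hray : forall s, 0 <= s <= 1 -> Cmod (RtoC s * z) <= Cmod z).
  { intros s Hs; rewrite Cmod_mult, Cmod_R, Rabs_right by lra; nra. }
  assert (Hphi : forall s, 0 <= s <= 1 -> is_derive phi s (dphi s)).
  { intros s Hs; pose proof (Hray s Hs).
    destruct (is_derive_along_ray f z _ s (Hd (RtoC s * z)%C ltac:(lra))) as [D1 D2].
    change (is_derive u s (fst (z * df (RtoC s * z))%C)) in D1.
    change (is_derive v s (snd (z * df (RtoC s * z))%C)) in D2.
    unfold phi, dphi; clearbody u v.
    auto_derive.
    - repeat split; eexists; eassumption.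
    - apply is_derive_unique in D1; apply is_derive_unique in D2.
      change (Derive (fun x : R => u x) s = fst (z * df (RtoC s * z))%C) in D1.
      change (Derive (fun x : R => v x) s = snd (z * df (RtoC s * z))%C) in D2.
      rewrite D1, D2; ring. }
  destruct (MVT_gen phi 0 1 dphi) as [c [Hc E]].
  - intros x Hx; rewrite Rmin_left, Rmax_right in Hx by lra; apply Hphi; lra.
  - intros x Hx; rewrite Rmin_left, Rmax_right in Hx by lra.
    apply continuity_pt_filterlim, (@ex_derive_continuous R_AbsRing R_NormedModule).
    eexists; apply Hphi; lra.
  - rewrite Rmin_left, Rmax_right in Hc by lra.
    assert (P1 : phi 1 = 0).
    { unfold phi, u, v; rewrite Cmult_1_l, Hfz; simpl; ring. }
    assert (P0 : 0 < phi 0).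
    { unfold phi, u, v; rewrite Cmult_0_l, Rmult_0_r, exp_0, Rmult_1_r.
      apply Cmod_gt_0 in H0; pose proof (Cmod_sqr (f (RtoC 0))) as S.
      unfold Rsqr in S; rewrite <- S; nra. }
    (* Inserting f' = f g turns the bracket into 2 |f|^2 (K + Re (z g)), which is nonnegative since
       |z g| <= K. The mean value theorem then contradicts phi 1 = 0 < phi 0. *)
    assert (Pc : 0 <= dphi c).
    { unfold dphi; apply Rmult_le_pos; [|left; apply exp_pos].
      pose proof (Hray c Hc) as Hcz.
      rewrite (Hode (RtoC c * z)%C) by lra.
      assert (B : Rabs (fst (z * g (RtoC c * z)%C)%C) <= K).
      { eapply Rle_trans; [apply re_le_Cmod|]; rewrite Cmod_mult.
        pose proof (HK _ Hcz); pose proof (Cmod_ge_0 (g (RtoC c * z)%C)); nra. }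
      apply Rabs_le_between in B.
      unfold u, v; destruct (f (RtoC c * z)%C) as [p q], (g (RtoC c * z)%C) as [r s].
      destruct z as [x y]; simpl in *.
      pose proof (Rle_0_sqr p); pose proof (Rle_0_sqr q); unfold Rsqr in *.
      replace (2 * _ + _) with (2 * ((p * p + q * q) * (K + (x * r - y * s)))) by ring.
      apply Rmult_le_pos; [lra|]; apply Rmult_le_pos; lra. }
    lra.
Qed.

Lemma ode_nonvanishing (z : C) : inD z -> pser ode_coef z <> RtoC 0.
Proof.
  intros Hz; pose proof radius1_ode_coef as Hf; pose proof radius1_xiC as Hg.
  apply (linear_ode_nonvanishing (pser ode_coef) (pser (dcoef ode_coef)) (pser xiC) z
    (Series (fun n => Cmod (xiC n) * Cmod z ^ n))); auto using is_derive_pser, ode_equation.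
  - intros y Hy; apply pser_norm_le; [exact Hg| |exact Hy].
    split; [apply Cmod_ge_0|exact Hz].
  - rewrite (pser_0 _ Hf); intros E; apply RtoC_inj in E; lra.
Qed.

Definition extremal_coef (n : nat) : C :=
  match n with O => RtoC 0 | S m => ode_coef m end.

Lemma radius1_extremal : radius1 extremal_coef.
Proof.
  apply radius1_bounded with 1; intros [|n]; simpl; [rewrite Cmod_0; lra|apply ode_coef_bound].
Qed.

Lemma extremal_derivative (z : C) : inD z ->
  pser (dcoef extremal_coef) z = (pser ode_coef z * xi z)%C.
Proof.
  intros Hz; pose proof radius1_ode_coef as Hf; pose proof (radius1_nat _ Hf) as Hn.
  rewrite xi_expansion by exact Hz.
  replace (pser ode_coef z * (1 + z * pser xiC z))%C
    with (pser ode_coef z + z * (pser ode_coef z * pser xiC z))%C by ring.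
  rewrite <- (ode_equation z Hz).
  transitivity (pser ode_coef z + pser (fun n => RtoC (INR n) * ode_coef n)%C z)%C.
  - rewrite <- (pser_plus _ _ z Hf Hn Hz); apply pser_ext; intros n.
    unfold dcoef; simpl extremal_coef; rewrite S_INR, RtoC_plus; ring.
  - rewrite (pser_shift _ z Hn Hz); simpl (INR 0); unfold dcoef; ring.
Qed.

Lemma extremal_in_S_star : S_star_xi (pser extremal_coef).
Proof.
  pose proof radius1_extremal as Ha.
  assert (D0 : dcoef extremal_coef 0 = RtoC 1).
  { unfold dcoef; simpl; change (ode_coef 0) with (RtoC 1); ring. }
  split.
  - split; [|split].
    + intros z Hz; eexists; now apply is_derive_pser.
    + now rewrite (pser_0 _ Ha).
    + rewrite <- D0, <- (pser_0 _ (radius1_dcoef _ Ha)); apply is_derive_pser; auto using inD_0.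
  - exists (fun z => z); split; [|split; [reflexivity|split; [auto|]]].
    + intros z _; exists (RtoC 1).
      apply (quotient_is_derive (fun y => y) (fun _ => RtoC 1)).
      * apply near_true; intros; ring.
      * exact (taylor_cont 0 _ _ (taylor_const 1 z (RtoC 1))).
    + intros z Hz Hn; pose proof (ode_nonvanishing z Hz) as N.
      assert (E : pser extremal_coef z = (z * pser ode_coef z)%C).
      { rewrite (pser_shift _ z Ha Hz); simpl; rewrite Cplus_0_l; reflexivity. }
      split; [rewrite E; now apply Cmult_neq_0|].
      intros d Hd; rewrite (derive_unique _ _ _ _ Hd (is_derive_pser _ z Ha Hz)).
      rewrite (extremal_derivative z Hz), E; field; auto.
Qed.

Lemma extremal_coeffs_of : coeffs_of (pser extremal_coef) extremal_coef.
Proof. intros z Hz; apply coeffs_csum, pser_csum; [apply radius1_extremal|exact Hz]. Qed.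

(** The general relations with w = z, so k1 = 1 and k2 = k3 = 0, give the values without unrolling
    the recursion. *)
Lemma extremal_values : Cmod (extremal_coef 2) = 1 /\ Cmod (extremal_coef 3) = 1 /\
  Cmod (extremal_coef 4) = 17 / 18.
Proof.
  destruct (coefficient_relations extremal_coef (fun z => z) (RtoC 1) (RtoC 0) (RtoC 0))
    as [R1 [R2 R3]]; auto using radius1_extremal, hol_id.
  - exists (fun _ => RtoC 0); split; [apply taylor_const|apply near_true; intros; ring].
  - intros z Hz; exact (extremal_derivative z Hz).
  - apply (f_equal Cmod) in R1; rewrite Cmod_1 in R1.
    apply (f_equal Cmod) in R2; rewrite !Cmod_mult, Cmod_R in R2.
    replace (RtoC 0 + RtoC 2 * (1 * 1))%C with (RtoC 2) in R2 by ring.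
    apply (f_equal Cmod) in R3; rewrite !Cmod_mult, Cmod_R in R3.
    replace (RtoC 0 + RtoC (7 / 2) * (1 * 0) + RtoC (17 / 6) * (1 * 1 * 1))%C
      with (RtoC (17 / 6)) in R3 by ring.
    rewrite !Cmod_R, !Rabs_right in R2 by lra; rewrite !Cmod_R, !Rabs_right in R3 by lra.
    repeat split; lra.
Qed.

Theorem theorem3p2 :
  (forall (f : C -> C) (a : nat -> C),
      S_star_xi f -> coeffs_of f a ->
      Cmod (a 2%nat) <= 1 /\ Cmod (a 3%nat) <= 1 /\ Cmod (a 4%nat) <= 17 / 18) /\
  (exists (f : C -> C) (a : nat -> C),
      S_star_xi f /\ coeffs_of f a /\ Cmod (a 2%nat) = 1) /\
  (exists (f : C -> C) (a : nat -> C),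
      S_star_xi f /\ coeffs_of f a /\ Cmod (a 3%nat) = 1) /\
  (exists (f : C -> C) (a : nat -> C),
      S_star_xi f /\ coeffs_of f a /\ Cmod (a 4%nat) = 17 / 18).
Proof.
  split; [exact coefficient_bounds|].
  destruct extremal_values as [E2 [E3 E4]].
  repeat split; exists (pser extremal_coef), extremal_coef;
    auto using extremal_in_S_star, extremal_coeffs_of.
Qed.
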